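(* Let $d\ge2$ and $a>0$. There is a constant $c_\circ(a,d)$ with $$c_\circ(a,d)\ge(8d)^{-1}(3\pi^{-4})^{d-1}a^{d-2}\left(\tfrac\pi2-a\right)^{d-1}\ge2\cdot0.02^d\,a^{d-2}\left(\tfrac\pi2-a\right)^{d-1}$$ such that the following holds. Let $K\in\overline{\mathcal{K}}^d_s$ and $\varepsilon\in(0,1]$. If $\Sigma_r(K)\ge a$ and $\vartheta_r(K)\ge\varepsilon$, then $$U_1(K)\ge\left(1+c_\circ(a,d)\,\varepsilon^{\frac{d+1}{2}}\right)U_1(B_s(e,a)),$$ where $e\in\mathbb{S}^d$ is arbitrary.
   Context: $\mathbb{S}^d$ is the unit sphere in $\mathbb{R}^{d+1}$ ($d\ge2$), $\sigma_d^\circ$ its normalized (probability) spherical Lebesgue measure, $B_s(x,r)$ the closed geodesic ball. $\overline{\mathcal{K}}^d_s$ is the set of spherically convex bodies, i.e. intersections of $\mathbb{S}^d$ with a closed convex cone in $\mathbb{R}^{d+1}$ that is not a linear subspace. $U_1(K)=\frac12\int_{\mathbb{S}^d}\mathbf 1\{x^\perp\cap K\neq\emptyset\}\,\sigma_d^\circ(dx)$. For $K\in\overline{\mathcal{K}}^d_s$ and $e\in K$: $r_e(K)=\max\{r\ge0:B_s(e,r)\subset K\}$, $R_e(K)=\min\{r\ge0:K\subset B_s(e,r)\}$; $\Sigma_r(K)=\max\{r_e(K):e\in K\}$ (the inradius), and $\vartheta_r(K)=\min\{R_e(K)-r_e(K):e\in K,\ r_e(K)=\Sigma_r(K)\}$.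 (Since inradii of spherically convex bodies are at most $\pi/2$, the hypothesis $\Sigma_r(K)\ge a$ forces $a\le\pi/2$.)
   Formalization: The second inequality, between the two explicit lower bounds, is asserted only for a ≤ π/2; for a > π/2 and even d it is false (e.g. d = 2, a = 2), because (π/2 − a)^{d−1} is negative. *)

(* Defs.v *)
From HB Require Import structures.
From mathcomp Require Import all_boot all_order all_algebra.
From mathcomp Require Import all_classical all_reals all_analysis.

Set Implicit Arguments.
Unset Strict Implicit.
Unset Printing Implicit Defensive.

Import Order.TTheory GRing.Theory Num.Theory.
Import numFieldNormedType.Exports.

Local Open Scope classical_set_scope.
Local Open Scope ring_scope.

Section euclidean.
Context {R : realType} {n : nat}.
Implicit Types (u v : 'rV[R]_n) (C : set 'rV[R]_n).

Definition dotp u v : R := \sum_i u 0 i * v 0 i.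

(* The library norm `|u| on row vectors is the sup norm; it induces the same
   topology, but lengths and angles need the Euclidean one. *)
Definition enorm u : R := Num.sqrt (dotp u u).

Definition orthocomp u : set 'rV[R]_n := [set v | dotp u v = 0].

Definition convex_cone C : Prop :=
  [/\ C !=set0, (forall (t : R) u, 0 <= t -> C u -> C (t *: u)) &
      convex_set C].

Definition linear_subspace C : Prop :=
  exists V : {vspace 'rV[R]_n}, C = [set` V].

End euclidean.

(* Lebesgue measure on Borel subsets of R^n, as the product of n copies of the
   one-dimensional one: the integral over the first coordinate of the measure
   of the section, as in the library's product_measure1. *)
Fixpoint lebesgue_rV (R : realType) (n : nat) : set 'rV[R]_n -> \bar R :=
  match n with
  | 0 => fun A => (\1_A 0)%:E
  | m.+1 => fun A => (\int[@lebesgue_measure R]_x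
      lebesgue_rV [set v : 'rV[R]_m | A (row_mx (x%:M : 'rV[R]_1) v)])%E
  end.

Section sphere.
Context {R : realType} (d : nat).

Definition sphere : set 'rV[R]_d.+1 := [set x | enorm x = 1].

(* Spherical Lebesgue measure is, up to a constant factor, the Lebesgue measure
   of the part of the unit ball lying on rays through the given set. *)
Definition cone_over (A : set 'rV[R]_d.+1) : set 'rV[R]_d.+1 :=
  [set x | 0 < enorm x <= 1 /\ A ((enorm x)^-1 *: x)].

Definition sphere_measure
    (A : set (g_sigma_algebraType (@open 'rV[R]_d.+1))) : \bar R :=
  (lebesgue_rV (cone_over A) *
   ((fine (lebesgue_rV (cone_over sphere)))^-1)%:E)%E.

End sphere.

Arguments sphere {R} d _.
Arguments sphere_measure {R} d _.

Section spherical_convexity.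
Context {R : realType} {d : nat}.
Implicit Types (K : set 'rV[R]_d.+1) (e : 'rV[R]_d.+1) (r : R).

Definition sball e r : set 'rV[R]_d.+1 :=
  [set y | sphere d y /\ acos (dotp e y) <= r].

Definition sconvex_body K : Prop :=
  exists C : set 'rV[R]_d.+1,
    [/\ closed C, convex_cone C, ~ linear_subspace C & K = sphere d `&` C].

(* For K a spherically convex body and e in K, each sup and inf below is
   attained, i.e. it is a maximum, resp. a minimum. *)
Definition inradius_at K e : R := sup [set r | 0 <= r /\ sball e r `<=` K].

Definition circumradius_at K e : R := inf [set r | 0 <= r /\ K `<=` sball e r].

Definition inradius K : R := sup [set inradius_at K e | e in K].

Definition vartheta_r K : R :=
  inf [set circumradius_at K e - inradius_at K e |
       e in [set e | K e /\ inradius_at K e = inradius K]].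

Definition U1 K : R :=
  2^-1 * fine (\int[sphere_measure d]_(x in sphere d)
    (\1_[set y : 'rV[R]_d.+1 | orthocomp y `&` K !=set0] x)%:E).

End spherical_convexity.

(* Main.v *)
(* With [C] the cone of [K], let [e0] be an incentre whose circumradius realises
   the hypothesis on [vartheta_r]; then [K] contains the ball [B] of radius [a]
   about [e0] and a point [y] at angle at least [a + 3/4 eps] from [e0].  Great
   hyperspheres hitting [B] hit [K], so it suffices to bound below the measure of
   the [x] whose hyperplane misses [B] but not [K].  Among them are the [x] at
   angle less than [r = pi/2 - a] from [-e0] with [0 <= <x, y>]: a segment from
   [e0] to [y] crosses such a hyperplane.  They form a cap of depth about [eps]
   in a ball of radius [r], and the cone over it contains a box which is a product
   of a segment, a segment of length of order [eps] and a (d-1)-ball of radius of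
   order [sqrt (eps * r)]; hence the power [eps^((d+1)/2)].
   That the measure of a ball depends on its radius only is the rotation invariance
   of Lebesgue measure, obtained from the uniqueness of translation invariant
   measures. *)
Require Import Defs.
From HB Require Import structures.
From mathcomp Require Import all_boot all_order all_algebra.
From mathcomp Require Import all_classical all_reals all_analysis.
From mathcomp Require Import measurable_realfun ring lra.
Import Order.TTheory GRing.Theory Num.Theory.
Import numFieldNormedType.Exports.
Local Open Scope classical_set_scope.
Local Open Scope ring_scope.

Set Implicit Arguments.
Unset Strict Implicit.
Unset Printing Implicit Defensive.

(** * Lebesgue measure on row vectors *)

(** No volume of a ball is ever evaluated. The volume of the box carries the volume of the unit
    (d-1)-ball as a factor. The cone over the sphere lies in the unit (d+1)-ball, whose volume is at
    most 4 times that of the (d-1)-ball; this bounds the cone of the normals whose hyperplanes hit B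
    by the same factor, which then drops out, as does the normalisation of the spherical measure.
    Determinants are avoided in the same spirit: an identity between two translation invariant
    measures, tested on a box or on a ball, yields both scaling and isometry invariance.

    The parameter eps is shared out as follows. The axis of the box makes the angle r - eps/2 with
    -e0, and in the plane of e0 and y the box stays within eps/4 of that axis. So it keeps an angle
    eps/4 from the boundary of the ball of radius r, which pays for its extent in the other d-1
    directions, and it satisfies 0 <= <x, y> once y is at angle a + eps/2 + eps/4 from e0. Asking
    for 3/4 eps instead of eps also makes it unnecessary to know that the circumradius is
    attained. *)

Notation borel_rV R n := (g_sigma_algebraType (@open 'rV[R]_n)).

Lemma measurable_rV_open (R : realType) n (U : set 'rV[R]_n) :
  open U -> @measurable _ (borel_rV R n) U.
Proof. exact: sub_gen_smallest. Qed.

Lemma measurable_rV_closed (R : realType) n (U : set 'rV[R]_n) :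
  closed U -> @measurable _ (borel_rV R n) U.
Proof.
move=> cU; rewrite -(setCK U); apply: measurableC.
exact: measurable_rV_open (closed_openC cU).
Qed.

Lemma continuous_measurable_rV (R : realType) n (f : 'rV[R]_n -> R) :
  continuous f -> measurable_fun [set: borel_rV R n] f.
Proof.
move=> /continuousP cf; apply: (measurability _ (RGenOpens.measurableE R)).
move=> _ [_ [a [b ->] <-]]; rewrite setTI.
by apply: measurable_rV_open; apply: cf; exact: interval_open.
Qed.

Lemma measurable_coord (R : realType) n (i : 'I_n) :
  measurable_fun [set: borel_rV R n] (fun x : 'rV[R]_n => x 0 i).
Proof. by apply: continuous_measurable_rV => x; exact: coord_continuous. Qed.

(* An open set is the union of the boxes with rational data it contains. *)
Lemma measurable_fun_rV (R : realType) n d (T : measurableType d)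
    (g : T -> 'rV[R]_n) :
  (forall i, measurable_fun [set: T] (fun x => g x 0 i)) ->
  measurable_fun [set: T] (g : T -> borel_rV R n).
Proof.
move=> mg.
apply: (@measurability _ _ T (borel_rV R n) setT g (@open 'rV[R]_n) erefl).
move=> _ [U oU <-].
rewrite setTI.
pose box (cr : 'rV[rat]_n * 'rV[rat]_n) : set 'rV[R]_n :=
  [set x | forall i, ball (ratr (cr.1 0 i) : R) (ratr (cr.2 0 i)) (x 0 i)].
pose F cr := if pselect (box cr `<=` U) then g @^-1` box cr else set0.
have -> : g @^-1` U = \bigcup_cr F cr.
  apply/seteqP; split => [x Ux|x [cr _]]; last first.
    by rewrite /F; case: pselect => // h; exact: h.
  have [P nP PU] := open_nbhs_nbhs (conj oU Ux).
  have /choice[c cP] : forall i, exists cr : rat * rat,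
      ball (ratr cr.1 : R) (ratr cr.2) (g x 0 i) /\
      ball (ratr cr.1 : R) (ratr cr.2) `<=` P 0 i.
    move=> i; have : (P 0 i)° (g x 0 i) by exact: nP.
    have oP : open (P 0 i)° by exact: open_interior.
    move=> /mem_set /(open_subball_rat oP) [a [b]] /= [/set_mem h1 h2].
    by exists (a, b); split => // y /h2 /interior_subset.
  exists (\row_i (c i).1, \row_i (c i).2) => //; rewrite /F.
  case: pselect => [h|[]].
    by move=> i; rewrite !mxE; case: (cP i).
  move=> y yb; apply: PU => i j; rewrite ord1.
  by have := yb j; rewrite !mxE /=; case: (cP j) => _; apply.
apply: countable_bigcupT_measurable => // cr; rewrite /F; case: pselect => /= [_|_] //.
have -> : g @^-1` box cr =
    \bigcap_(i in [set: 'I_n])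
      (fun x => g x 0 i) @^-1` ball (ratr (cr.1 0 i) : R) (ratr (cr.2 0 i)).
  by apply/seteqP; split => [x bx i _|x bx i]; [exact: bx|exact: bx].
apply: fin_bigcap_measurable => // i _; rewrite -[X in measurable X]setTI.
by apply: mg => //; apply: open_measurable; exact: ball_open.
Qed.

Lemma row_mx_head (R : realType) m (x : R) (v : 'rV[R]_m) :
  (row_mx (x%:M : 'rV_1) v : 'rV_m.+1) 0 ord0 = x.
Proof.
have -> : ord0 = lshift m (0 : 'I_1) by exact: val_inj.
by apply: etrans (row_mxEl _ _ _ _) _; rewrite mxE eqxx mulr1n.
Qed.

Lemma row_mx_tail (R : realType) m (x : R) (v : 'rV[R]_m) (i : 'I_m) :
  (row_mx (x%:M : 'rV_1) v : 'rV_m.+1) 0 (lift ord0 i) = v 0 i.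
Proof.
have -> : lift ord0 i = rshift 1 i by exact: val_inj.
exact: row_mxEr.
Qed.

Lemma row_mx_eta (R : realType) m (x : 'rV[R]_m.+1) :
  x = row_mx ((x 0 0)%:M : 'rV_1) (\row_i x 0 (lift ord0 i)).
Proof.
apply/rowP => i; case: (unliftP ord0 i) => [j|] ->.
  by rewrite row_mx_tail mxE.
by rewrite row_mx_head.
Qed.

Lemma measurable_row_mx (R : realType) m :
  measurable_fun [set: measurableTypeR R * borel_rV R m]
    (fun p => row_mx (p.1%:M : 'rV_1) p.2 : borel_rV R m.+1).
Proof.
apply: (@measurable_fun_rV R m.+1) => i; case: (unliftP ord0 i) => [j|] ->.
  under eq_fun do rewrite row_mx_tail.
  apply: (@measurableT_comp _ _ _ _ _ _ (fun x : borel_rV R m => (x : 'rV[R]_m) 0 j)).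
    exact: measurable_coord.
  exact: measurable_snd.
under eq_fun do rewrite row_mx_head.
exact: measurable_fst.
Qed.

Lemma measurable_row_split (R : realType) m :
  measurable_fun [set: borel_rV R m.+1]
    (fun y => ((y : 'rV[R]_m.+1) 0 0, \row_i (y : 'rV[R]_m.+1) 0 (lift ord0 i))
      : measurableTypeR R * borel_rV R m).
Proof.
apply: measurable_fun_pair; first exact: measurable_coord.
apply: measurable_fun_rV => i; under eq_fun do rewrite mxE.
exact: measurable_coord.
Qed.

(** * Lebesgue measure as an iterated pushforward of product measures *)

Section sigma_finite_pushforward.
Context d1 d2 (T1 : measurableType d1) (T2 : measurableType d2) (R : realType).
Variables (f : T1 -> T2) (g : T2 -> T1).
Hypotheses (mf : measurable_fun setT f) (mg : measurable_fun setT g).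
Hypothesis fK : cancel f g.
Variable mu : {measure set T1 -> \bar R}.
Hypothesis mu_sigma_finite : sigma_finite setT mu.

Let nu := pushforward mu f.

Let nu0 : nu set0 = 0%E. Proof. exact: measure0. Qed.

Let nu_ge0 A : (0 <= nu A)%E. Proof. exact: measure_ge0. Qed.

Let nu_sigma_additive : semi_sigma_additive nu.
Proof. exact: measure_semi_sigma_additive. Qed.

HB.instance Definition _ :=
  isMeasure.Build _ _ _ nu nu0 nu_ge0 nu_sigma_additive.

Let nu_sigma_finite : sigma_finite setT nu.
Proof.
have /sigma_finiteP[G [GT _ Goo]] := mu_sigma_finite.
exists (fun k => g @^-1` G k).
  by rewrite -preimage_bigcup -GT preimage_setT.
move=> k; have [mG Gfin] := Goo k; split.
  by rewrite -[X in measurable X]setTI; apply: mg.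
rewrite /nu /= /pushforward /=.
suff -> : f @^-1` (g @^-1` G k) = G k by [].
by apply/seteqP; split => p /=; rewrite fK.
Qed.

HB.instance Definition _ :=
  Measure_isSigmaFinite.Build _ _ _ nu nu_sigma_finite.

(** The left inverse [g] pulls an exhaustion of the source back to one of the target. The measure is
    returned existentially so that an induction on the dimension can produce it. *)
Lemma sigma_finite_pushforward :
  exists nu' : {sigma_finite_measure set T2 -> \bar R},
    forall A, nu' A = mu (f @^-1` A).
Proof.
by exists nu.
Qed.

End sigma_finite_pushforward.

Lemma product_measure_sigma_finite d1 d2 (T1 : measurableType d1)
    (T2 : measurableType d2) (R : realType)
    (m1 : {sigma_finite_measure set T1 -> \bar R})
    (m2 : {sigma_finite_measure set T2 -> \bar R}) :
  sigma_finite setT (m1 \x m2)%E.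
Proof.
have /sigma_finiteP[F [TF ndF Foo]] := sigma_finiteT m1.
have /sigma_finiteP[G [TG ndG Goo]] := sigma_finiteT m2.
exists (fun n => F n `*` G n).
  apply/seteqP; split => // -[x y] _.
  have [i _ Fx] : (\bigcup_i F i) x by rewrite -TF.
  have [j _ Gy] : (\bigcup_i G i) y by rewrite -TG.
  exists (maxn i j) => //; split => /=.
    by move: x Fx; exact/subsetPset/ndF/leq_maxl.
  by move: y Gy; exact/subsetPset/ndG/leq_maxr.
move=> k; have [mF Fk] := Foo k; have [mG Gk] := Goo k.
split; first exact: measurableX.
by rewrite product_measure1E// lte_mul_pinfty// ge0_fin_numE.
Qed.

(** In dimension m+1, [lebesgue_rV] is the image under [row_mx] of the product of the line with
    dimension m, because the product measure is also the integral of the measures of the sections;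
    in dimension 0 it is a Dirac mass. *)
Lemma lebesgue_rV_sigma_finite_measure (R : realType) n :
  exists mu : {sigma_finite_measure set (borel_rV R n) -> \bar R},
    forall A, mu A = lebesgue_rV A.
Proof.
elim: n => [|m [mu muE]]; first by exists (dirac (0 : borel_rV R 0)).
have [|nu nuE] := sigma_finite_pushforward (@measurable_row_mx R m)
  (@measurable_row_split R m) _
  (product_measure_sigma_finite (@lebesgue_measure R) mu).
  move=> [x v] /=; rewrite row_mx_head; congr pair.
  by apply/rowP => i; rewrite mxE row_mx_tail.
exists nu => A; rewrite nuE; apply: eq_integral => x _ /=.
apply: etrans (muE _); congr (mu _).
by apply/seteqP; split => v; rewrite /xsection /= inE.
Qed.

(* The type of the domain of this copy of [lebesgue_rV] carries the Borel
   sigma-algebra, so that measure instances can be attached to it. *)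
Definition lebesgueB (R : realType) n : set (borel_rV R n) -> \bar R :=
  @lebesgue_rV R n.
Arguments lebesgueB : clear implicits.

Section lebesgueB_measure.
Context {R : realType} {n : nat}.
Local Notation lam := (lebesgueB R n).

Let lam0 : lam set0 = 0%E.
Proof.
have [mu muE] := lebesgue_rV_sigma_finite_measure R n.
by rewrite /lebesgueB -muE measure0.
Qed.

Let lam_ge0 A : (0 <= lam A)%E.
Proof.
by have [mu muE] := lebesgue_rV_sigma_finite_measure R n; rewrite /lebesgueB -muE.
Qed.

Let lam_sigma_additive : semi_sigma_additive lam.
Proof.
have [mu muE] := lebesgue_rV_sigma_finite_measure R n.
have -> : lam = mu by apply/funext => A; rewrite muE.
exact: measure_semi_sigma_additive.
Qed.

HB.instance Definition _ :=
  isMeasure.Build _ _ _ lam lam0 lam_ge0 lam_sigma_additive.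

Let lam_sigma_finite : sigma_finite setT lam.
Proof.
have [mu muE] := lebesgue_rV_sigma_finite_measure R n.
have -> : lam = mu by apply/funext => A; rewrite muE.
exact: sigma_finiteT.
Qed.

HB.instance Definition _ :=
  Measure_isSigmaFinite.Build _ _ _ lam lam_sigma_finite.

End lebesgueB_measure.

Lemma measurable_row_section (R : realType) m (A : set (borel_rV R m.+1)) x :
  measurable A -> measurable ([set v | A (row_mx (x%:M : 'rV_1) v)] : set (borel_rV R m)).
Proof.
move=> mA; rewrite -[X in measurable X]setTI.
have mx : measurable_fun setT
    (fun v : borel_rV R m => (x, v) : measurableTypeR R * borel_rV R m).
  exact: measurable_fun_pair.
exact: (measurableT_comp (@measurable_row_mx R m) mx).
Qed.

Lemma measurable_fun_row_section (R : realType) m (A : set (borel_rV R m.+1)) :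
  measurable A ->
  measurable_fun [set: measurableTypeR R]
    (fun x => lebesgueB R m [set v | A (row_mx (x%:M : 'rV_1) v)]).
Proof.
move=> mA.
have := measurable_fun_xsection (lebesgueB R m)
  (measurable_row_mx (R := R) (m := m) measurableT mA).
congr measurable_fun; apply/funext => x /=; congr (lebesgueB _ _ _).
by apply/seteqP; split => v; rewrite /xsection setTI /= inE.
Qed.

(** * Translation invariance and linear changes of variable *)

Lemma lebesgue_measure_translation (R : realType) (c : R) (A : set (measurableTypeR R)) :
  measurable A -> lebesgue_measure ((fun x => x + c) @^-1` A) = lebesgue_measure A.
Proof.
have mc : measurable_fun setT (fun x : measurableTypeR R => x + c : measurableTypeR R).
  exact: measurable_funD.
have mNc : measurable_fun setT (fun x : measurableTypeR R => x - c : measurableTypeR R).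
  exact: measurable_funD.
have [|nu nuE] := sigma_finite_pushforward mc mNc _ (sigma_finiteT lebesgue_measure).
  exact: addrK.
move=> mA; rewrite -nuE; apply/esym.
apply: (@lebesgue_measure_unique R nu) => // _ [[a b] _ <-].
apply: etrans (esym (nuE _)) => /=.
have -> : (fun x => x + c) @^-1` `]a, b]%classic = `](a - c), (b - c)]%classic.
  by apply/seteqP; split => x; rewrite /= !in_itv /= ltrBlDr lerBrDr.
rewrite !lebesgue_measure_itv /= !lte_fin ltrD2r; case: ifP => // _.
by rewrite -!EFinD; congr EFin; ring.
Qed.

(** The section at [x] of the preimage is the preimage, under translation by the tail of [w], of the
    section of [A] at [x + w 0 0]. The induction hypothesis removes the tail, and invariance on the
    line removes the shift of [x]. *)
Lemma lebesgue_rV_translation (R : realType) n (w : 'rV[R]_n) (A : set (borel_rV R n)) :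
  measurable A -> lebesgueB R n ((fun x => x + w) @^-1` A) = lebesgueB R n A.
Proof.
elim: n w A => [|m IH] w A mA.
  congr (lebesgueB _ _ _); apply/seteqP.
  by split => x /=; rewrite (_ : x + w = x) //; apply/rowP; case.
pose g x := lebesgueB R m [set v | A (row_mx (x%:M : 'rV_1) v)].
pose T x : measurableTypeR R := x + w 0 0.
have mT : measurable_fun [set: measurableTypeR R] T by exact: measurable_funD.
transitivity (\int[@lebesgue_measure R]_x (g \o T) x)%E.
  apply: eq_integral => x _ /=.
  apply: etrans (IH (\row_i w 0 (lift ord0 i)) _ (measurable_row_section (T x) mA)).
  congr (lebesgueB _ _ _); apply/seteqP.
  suff E v : row_mx (x%:M : 'rV_1) v + w =
      row_mx ((T x)%:M : 'rV_1) (v + \row_i w 0 (lift ord0 i)).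
    by split => v /=; rewrite E.
  apply/rowP => i; case: (unliftP ord0 i) => [j|] ->.
    by rewrite mxE !row_mx_tail !mxE.
  by rewrite mxE !row_mx_head.
rewrite -[LHS](@ge0_integral_pushforward _ _ _ _ _ _ mT lebesgue_measure setT g) //.
- by apply: eq_measure_integral => B mB _; exact: lebesgue_measure_translation.
- exact: measurable_fun_row_section.
Qed.

Lemma measurable_rVD (R : realType) n d (T : measurableType d) (f g : T -> borel_rV R n) :
  measurable_fun setT f -> measurable_fun setT g ->
  measurable_fun setT (fun t => (f t : 'rV[R]_n) + g t : borel_rV R n).
Proof.
move=> mf mg; apply: measurable_fun_rV => i; under eq_fun do rewrite mxE.
by apply: measurable_funD; apply: (measurableT_comp (measurable_coord i)).
Qed.

Lemma measurable_rVM (R : realType) n m (M : 'M[R]_(n, m)) :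
  measurable_fun [set: borel_rV R n] (fun x => (x : 'rV[R]_n) *m M : borel_rV R m).
Proof.
apply: measurable_fun_rV => i; under eq_fun do rewrite mxE.
apply: measurable_sum => j; apply: measurable_funM => //.
exact: measurable_coord.
Qed.

Lemma measurable_rVN (R : realType) n :
  measurable_fun [set: borel_rV R n] (fun x => - (x : 'rV[R]_n) : borel_rV R n).
Proof.
have -> : (fun x => - (x : 'rV[R]_n) : borel_rV R n) =
    (fun x : 'rV[R]_n => x *m (-1)%:M : borel_rV R n).
  by apply/funext => x; rewrite mul_mx_scalar scaleN1r.
exact: measurable_rVM.
Qed.

Lemma measurable_preimageT d1 d2 (T1 : measurableType d1) (T2 : measurableType d2)
    (f : T1 -> T2) (A : set T2) :
  measurable_fun setT f -> measurable A -> measurable (f @^-1` A).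
Proof. by move=> mf mA; rewrite -[X in measurable X]setTI; exact: mf. Qed.

Section translation_invariant.
Context {R : realType} {n : nat}.
Variables mu nu : {sigma_finite_measure set (borel_rV R n) -> \bar R}.
Hypothesis mu_translation : forall (w : 'rV[R]_n) (A : set (borel_rV R n)),
  measurable A -> mu ((fun x : 'rV[R]_n => x + w) @^-1` A) = mu A.
Hypothesis nu_translation : forall (w : 'rV[R]_n) (A : set (borel_rV R n)),
  measurable A -> nu ((fun x : 'rV[R]_n => x + w) @^-1` A) = nu A.

(* Both sides are the measure of {(x, y) | x \in A, x + y \in B}, computed by
   integrating over y first, or over x first after the shift x := x - y. *)
Lemma translation_invariant_swap (A B : set (borel_rV R n)) :
  measurable A -> measurable B ->
  (mu A * nu B = mu B * nu ((fun x : 'rV[R]_n => (- x)%R) @^-1` A))%E.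
Proof.
move=> mA mB.
have prod12 (S : set (borel_rV R n * borel_rV R n)) : measurable S ->
    (mu \x nu)%E S = (mu \x^ nu)%E S.
  by apply: product_measure_unique => X Y mX mY; exact: product_measure2E.
have indicM (C D : set (borel_rV R n)) (F : borel_rV R n -> set (borel_rV R n)) :
    measurable C -> (forall x, nu (F x) = nu D) ->
    (\int[mu]_x nu ([set y | C x /\ F x y] : set (borel_rV R n)) = mu C * nu D)%E.
  move=> mC FD; rewrite (eq_integral (fun x => (\1_C x)%:E * nu D)%E).
    by rewrite ge0_integralZr ?integral_indic ?setIT//; exact: measurableT_comp.
  move=> x _; rewrite indicE; case: (boolP (x \in C)) => [/set_mem|/negP] Cx.
    by rewrite mul1e -(FD x); congr (nu _); apply/seteqP; split => [y []|y Fy].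
  rewrite mul0e (_ : [set y | _] = set0) ?measure0//.
  by apply/seteqP; split => // y [/mem_set].
have mN := @measurable_rVN R n.
pose S : set (borel_rV R n * borel_rV R n) :=
  [set p | A p.1 /\ B ((p.1 : 'rV[R]_n) + p.2)].
pose S' : set (borel_rV R n * borel_rV R n) :=
  [set p | B p.1 /\ A ((p.1 : 'rV[R]_n) - p.2)].
have mS : measurable S.
  apply: measurableI; first exact: measurable_preimageT.
  by apply: measurable_preimageT mB; exact: measurable_rVD.
have mS' : measurable S'.
  apply: measurableI; first exact: measurable_preimageT.
  apply: measurable_preimageT mA; apply: measurable_rVD => //.
  exact: (measurableT_comp mN).
transitivity ((mu \x nu)%E S).
  apply/esym; rewrite -(indicM A B (fun x y => B ((x : 'rV[R]_n) + y))) //.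
    apply: eq_integral => x _ /=; congr (nu _).
    by apply/seteqP; split => y; rewrite /xsection /= inE.
  move=> x; rewrite -[RHS](nu_translation x) //; congr (nu _).
  by apply/seteqP; split => y /=; rewrite addrC.
rewrite prod12 //; transitivity ((mu \x^ nu)%E S').
  apply: eq_integral => y _ /=.
  have mS'y : measurable (ysection S' y) by exact: measurable_ysection.
  rewrite -[RHS](mu_translation y) //; congr (mu _).
  apply/seteqP; split => x; rewrite /ysection /= !inE /S /S' /= addrK.
    by case.
  by case.
rewrite -prod12 // -(indicM B _ (fun x y => A ((x : 'rV[R]_n) - y))) //.
  apply: eq_integral => x _ /=; congr (nu _).
  by apply/seteqP; split => y; rewrite /xsection /= inE.
move=> x; rewrite -[RHS](nu_translation (- x)); last exact: (measurable_preimageT mN mA).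
by congr (nu _); apply/seteqP; split => y /=; rewrite opprB.
Qed.

End translation_invariant.

(** The image of Lebesgue measure under [M] is again translation invariant, since a shift by [w]
    after [M] is a shift by [w *m invmx M] before it; the swap identity then applies. It stands in
    for the determinant formula: a well chosen [A] reveals the scaling factor of [M]. *)
Lemma lebesgue_rV_linear (R : realType) n (M : 'M[R]_n) (A B : set (borel_rV R n)) :
  M \in unitmx -> measurable A -> measurable B ->
  (lebesgueB R n A * lebesgueB R n ((fun x : 'rV[R]_n => x *m M) @^-1` B) =
   lebesgueB R n B * lebesgueB R n ((fun x : 'rV[R]_n => (- (x *m M))%R) @^-1` A))%E.
Proof.
move=> uM mA mB.
have [|nu nuE] := sigma_finite_pushforward (measurable_rVM M)
  (measurable_rVM (invmx M)) _ (sigma_finiteT (lebesgueB R n)).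
  by move=> x; rewrite mulmxK.
rewrite -nuE translation_invariant_swap //.
- by rewrite nuE.
- by move=> w C mC; exact: lebesgue_rV_translation.
- move=> w C mC; rewrite !nuE -[RHS](lebesgue_rV_translation (w *m invmx M)).
    by congr (lebesgueB _ _ _); apply/seteqP; split => x /=; rewrite mulmxDl mulmxKV.
  by apply: measurable_preimageT mC; exact: measurable_rVM.
Qed.

(** * Euclidean structure and volumes *)

Section dot_product.
Context {R : realType} {n : nat}.
Implicit Types (u v w : 'rV[R]_n) (t : R).

Lemma dotpE u v : dotp u v = (u *m v^T) 0 0.
Proof. by rewrite mxE; apply: eq_bigr => i _; rewrite mxE. Qed.

Lemma dotpC u v : dotp u v = dotp v u.
Proof. by apply: eq_bigr => i _; rewrite mulrC. Qed.

Lemma dotpDl u v w : dotp (u + v) w = dotp u w + dotp v w.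
Proof. by rewrite !dotpE mulmxDl mxE. Qed.

Lemma dotpZl t u v : dotp (t *: u) v = t * dotp u v.
Proof. by rewrite !dotpE -scalemxAl mxE. Qed.

Lemma dotpDr u v w : dotp w (u + v) = dotp w u + dotp w v.
Proof. by rewrite !(dotpC w) dotpDl. Qed.

Lemma dotpZr t u v : dotp u (t *: v) = t * dotp u v.
Proof. by rewrite !(dotpC u) dotpZl. Qed.

Lemma dotpNl u v : dotp (- u) v = - dotp u v.
Proof. by rewrite -scaleN1r dotpZl mulN1r. Qed.

Lemma dotpNr u v : dotp u (- v) = - dotp u v.
Proof. by rewrite !(dotpC u) dotpNl. Qed.

Lemma dotpBl u v w : dotp (u - v) w = dotp u w - dotp v w.
Proof. by rewrite dotpDl dotpNl. Qed.

Lemma dotpBr u v w : dotp w (u - v) = dotp w u - dotp w v.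
Proof. by rewrite dotpDr dotpNr. Qed.

Lemma dotp_ge0 u : 0 <= dotp u u.
Proof. by apply: sumr_ge0 => i _; rewrite -expr2 sqr_ge0. Qed.

Lemma dotp_eq0 u : (dotp u u == 0) = (u == 0).
Proof.
apply/eqP/eqP => [/eqP|->]; last by rewrite dotpE mul0mx mxE.
rewrite psumr_eq0 => [/allP h|i _]; last by rewrite -expr2 sqr_ge0.
apply/rowP => i; rewrite mxE; apply/eqP.
by have := h i (mem_index_enum i); rewrite mulf_eq0 orbb.
Qed.

Lemma enorm_ge0 u : 0 <= enorm u.
Proof. exact: sqrtr_ge0. Qed.

Lemma sqr_enorm u : enorm u ^+ 2 = dotp u u.
Proof. exact/sqr_sqrtr/dotp_ge0. Qed.

Lemma enorm_gt0 u : (0 < enorm u) = (u != 0).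
Proof. by rewrite sqrtr_gt0 lt_def dotp_eq0 dotp_ge0 andbT. Qed.

Lemma enormZ t u : enorm (t *: u) = `|t| * enorm u.
Proof.
by rewrite /enorm dotpZl dotpZr mulrA -expr2 sqrtrM ?sqr_ge0// sqrtr_sqr.
Qed.

Lemma enormN u : enorm (- u) = enorm u.
Proof. by rewrite -scaleN1r enormZ normrN normr1 mul1r. Qed.

Lemma enorm_le u t : 0 <= t -> (enorm u <= t) = (dotp u u <= t ^+ 2).
Proof. by move=> t0; rewrite -sqr_enorm ler_sqr// nnegrE// enorm_ge0. Qed.

Lemma dotp_CauchySchwarz u v : dotp u v ^+ 2 <= dotp u u * dotp v v.
Proof.
have [->|v0] := eqVneq v 0.
  by rewrite !dotpE trmx0 !mulmx0 mxE expr0n /= mulr0.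
have vv : 0 < dotp v v by rewrite lt_def dotp_eq0 v0 dotp_ge0.
have := dotp_ge0 (dotp v v *: u - dotp u v *: v).
rewrite !(dotpBl, dotpBr, dotpZl, dotpZr) (dotpC v u).
set a := dotp u u; set b := dotp u v; set c := dotp v v => h.
rewrite -subr_ge0 -(pmulr_rge0 _ vv) -/c.
by apply: le_trans h _; rewrite le_eqVlt; apply/orP; left; apply/eqP; ring.
Qed.

Lemma dotp_le u v : dotp u v <= enorm u * enorm v.
Proof.
apply: le_trans (ler_norm _) _.
rewrite -ler_sqr ?nnegrE ?mulr_ge0 ?enorm_ge0// exprMn !sqr_enorm.
by rewrite real_normK ?num_real// dotp_CauchySchwarz.
Qed.

Lemma dotp_unit_bound u v : enorm u = 1 -> enorm v = 1 -> -1 <= dotp u v <= 1.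
Proof.
move=> u1 v1; rewrite -ler_norml.
have := dotp_CauchySchwarz u v; rewrite -!sqr_enorm u1 v1 !expr1n mulr1 => h.
by rewrite -ler_sqr ?nnegrE// expr1n real_normK ?num_real.
Qed.

Lemma continuous_dotp (T : topologicalType) (f g : T -> 'rV[R]_n) :
  continuous f -> continuous g -> continuous (fun x => dotp (f x) (g x)).
Proof.
move=> cf cg x.
apply: (cvg_big add_continuous (Ff := fun i x => f x 0 i * g x 0 i)) => i _.
by apply: cvgM;
  [apply: (continuous_comp (cf x) (@coord_continuous _ _ _ _ _ _))
  |apply: (continuous_comp (cg x) (@coord_continuous _ _ _ _ _ _))].
Qed.

Lemma continuous_enorm : continuous (@enorm R n).
Proof.
move=> u; apply: continuous_comp; last exact: sqrt_continuous.
by apply: (@continuous_dotp _ idfun idfun) => x; exact: cvg_id.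
Qed.

End dot_product.

Lemma dotp_row_mx (R : realType) n (a b : R) (u v : 'rV[R]_n) :
  dotp (row_mx (a%:M : 'rV_1) u : 'rV_n.+1) (row_mx (b%:M : 'rV_1) v) =
  a * b + dotp u v.
Proof.
rewrite /dotp big_ord_recl !row_mx_head; congr (_ + _).
by apply: eq_bigr => i _; rewrite !row_mx_tail.
Qed.

(** * Volumes of Euclidean balls *)

Definition eball {R : realType} n (r : R) : set (borel_rV R n) :=
  [set x | enorm (x : 'rV[R]_n) <= r].

Lemma measurable_eball (R : realType) n (r : R) : measurable (@eball R n r).
Proof.
apply: measurable_rV_closed.
apply: (@closed_comp _ _ (@enorm R n) [set y | y <= r]) => [x _|].
  exact: continuous_enorm.
exact: closed_le.
Qed.

Lemma le_lebesgue_rV (R : realType) n (A B : set (borel_rV R n)) :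
  measurable A -> measurable B -> A `<=` B -> (lebesgueB R n A <= lebesgueB R n B)%E.
Proof. by move=> mA mB; apply: (@le_measure _ _ _ (lebesgueB R n)); rewrite ?inE. Qed.

Lemma lebesgue_rV_setX (R : realType) m (I : set (measurableTypeR R))
    (B : set (borel_rV R m)) (A : set (borel_rV R m.+1)) :
  measurable I ->
  (forall x v, A (row_mx (x%:M : 'rV_1) v) <-> I x /\ B v) ->
  lebesgueB R m.+1 A = (lebesgue_measure I * lebesgueB R m B)%E.
Proof.
move=> mI AE.
transitivity (\int[@lebesgue_measure R]_x ((\1_I x)%:E * lebesgueB R m B))%E.
  apply: eq_integral => x _; rewrite indicE.
  case: (boolP (x \in I)) => [/set_mem|/negP] Ix.
    rewrite mul1e; apply: (congr1 (lebesgueB R m)).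
    by apply/seteqP; split => v /=; rewrite AE => // -[].
  rewrite mul0e; apply: etrans (measure0 (lebesgueB R m)).
  apply: (congr1 (lebesgueB R m)).
  by apply/seteqP; split => // v /=; rewrite AE => -[/mem_set].
by rewrite ge0_integralZr ?integral_indic ?setIT//; exact: measurableT_comp.
Qed.

Definition rV_box {R : realType} n (r : R) : set (borel_rV R n) :=
  [set x | forall i, `|(x : 'rV[R]_n) 0 i| <= r].

Lemma measurable_rV_box (R : realType) n (r : R) : measurable (@rV_box R n r).
Proof.
have -> : rV_box r =
    \bigcap_(i in [set: 'I_n]) (fun x : 'rV[R]_n => x 0 i) @^-1` `[-r, r]%classic.
  apply/seteqP; split => x /= xr i.
    by move=> _; rewrite /= in_itv /= -ler_norml.
  by have := xr i I; rewrite /= in_itv /= -ler_norml.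
apply: fin_bigcap_measurable => // i _.
by apply: measurable_preimageT (measurable_itv _); exact: measurable_coord.
Qed.

Lemma lebesgue_rV_box (R : realType) n (r : R) : 0 <= r ->
  lebesgueB R n (rV_box r) = ((2 * r) ^+ n)%:E.
Proof.
move=> r0; elim: n => [|m IH].
  by rewrite /= indicE mem_set//= => -[].
rewrite (@lebesgue_rV_setX _ _ `[-r, r]%classic (rV_box r))//.
  rewrite lebesgue_measure_itv /= lte_fin IH exprS EFinM.
  have -> : 2 * r = r - - r by ring.
  by case: ltP => // h; have -> : r - - r = 0 by lra.
move=> x v; rewrite /= in_itv /= -ler_norml; split => [h|[xr vr] i].
  split; first by have := h 0; rewrite row_mx_head.
  by move=> i; have := h (lift ord0 i); rewrite row_mx_tail.
by case: (unliftP ord0 i) => [j|] ->; rewrite ?row_mx_tail ?row_mx_head.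
Qed.

Lemma coord_enorm (R : realType) n (x : 'rV[R]_n) i : `|x 0 i| <= enorm x.
Proof.
rewrite -ler_sqr ?nnegrE ?enorm_ge0// real_normK ?num_real// sqr_enorm.
rewrite /dotp (bigD1 i) //= -expr2 lerDl.
by apply: sumr_ge0 => j _; rewrite -expr2 sqr_ge0.
Qed.

Lemma eball_fin_num (R : realType) n (r : R) : lebesgueB R n (eball r) \is a fin_num.
Proof.
have [r0|r0] := ltP r 0.
  rewrite (_ : eball r = set0) ?measure0//; apply/seteqP; split => // x /=.
  by rewrite /eball /= leNgt (lt_le_trans r0)// enorm_ge0.
rewrite ge0_fin_numE//; apply: le_lt_trans (ltry ((2 * r) ^+ n)).
rewrite -lebesgue_rV_box //.
apply: (@le_lebesgue_rV R n (eball r) (rV_box r)).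
- exact: measurable_eball.
- exact: measurable_rV_box.
- by move=> x xr i; apply: le_trans xr; exact: coord_enorm.
Qed.

Lemma eball1_gt0 (R : realType) n : (0 < lebesgueB R n (eball 1))%E.
Proof.
pose r : R := n.+1%:R^-1.
have r0 : 0 < r by rewrite invr_gt0.
suff : (lebesgueB R n (rV_box r) <= lebesgueB R n (eball 1))%E.
  rewrite (lebesgue_rV_box n (ltW r0)) => h; apply: (lt_le_trans _ h).
  by rewrite lte_fin exprn_gt0// mulr_gt0.
apply: le_lebesgue_rV.
- exact: measurable_rV_box.
- exact: measurable_eball.
move=> x xr; rewrite /eball /= enorm_le// expr1n.
apply: (@le_trans _ _ (\sum_(i < n) r)).
  apply: ler_sum => i _; rewrite -expr2 -real_normK ?num_real//.
  apply: (@le_trans _ _ (r ^+ 2)); first by rewrite ler_sqr ?nnegrE// ltW.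
  by rewrite expr2 ler_piMl ?(ltW r0)// invf_le1 ?ler1n.
rewrite sumr_const card_ord -[r *+ n]mulr_natr /r mulrC ler_pdivrMr// mul1r.
by rewrite ler_nat.
Qed.

(** The ball lies in the cylinder over the ball of one dimension less. Used twice, this compares the
    cone over the sphere with the (d-1)-ball that is a factor of the box. *)
Lemma eball1_le (R : realType) n :
  (lebesgueB R n.+1 (eball 1) <= 2%:E * lebesgueB R n (eball 1))%E.
Proof.
pose C : set (borel_rV R n.+1) := [set x | x 0 0 \in `[-1, 1]%R /\
  eball 1 (\row_i x 0 (lift ord0 i) : 'rV[R]_n)].
have <- : lebesgueB R n.+1 C = (2%:E * lebesgueB R n (eball 1))%E.
  rewrite (@lebesgue_rV_setX _ _ `[-1, 1]%classic (eball 1)) //.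
    rewrite lebesgue_measure_itv /= lte_fin (_ : (-1 < 1 :> R) = true); last by lra.
    by congr (_ * _)%E; rewrite -EFinD; congr EFin; ring.
  move=> x v; rewrite /C /= row_mx_head.
  have -> : \row_i (row_mx (x%:M : 'rV_1) v : 'rV_n.+1) 0 (lift ord0 i) = v.
    by apply/rowP => i; rewrite mxE row_mx_tail.
  by [].
apply: (@le_lebesgue_rV R n.+1 (eball 1) C); first exact: measurable_eball.
  apply: measurableI.
    exact: (measurable_preimageT (@measurable_coord R n.+1 0) (measurable_itv `[-1, 1])).
  have mt : measurable_fun [set: borel_rV R n.+1]
      (fun x => \row_i (x : 'rV[R]_n.+1) 0 (lift ord0 i) : borel_rV R n).
    apply: measurable_fun_rV => i; under eq_fun do rewrite mxE.
    exact: measurable_coord.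
  exact: (measurable_preimageT mt (measurable_eball 1)).
move=> x x1; split; first by rewrite in_itv /= -ler_norml (le_trans (coord_enorm _ _)).
move: x1; rewrite /eball /= !enorm_le// expr1n; apply: le_trans.
by rewrite {3 4}(row_mx_eta x) dotp_row_mx lerDr -expr2 sqr_ge0.
Qed.

(** The homothety is tested on the unit box, whose preimages are boxes of known volume. *)
Lemma eball_scale (R : realType) n (r : R) : 0 < r ->
  lebesgueB R n (eball r) = ((r ^+ n)%:E * lebesgueB R n (eball 1))%E.
Proof.
move=> r0.
have uM : (r^-1%:M : 'M[R]_n) \in unitmx.
  by rewrite unitmxE det_scalar unitrX// unitfE gt_eqF// invr_gt0.
have := lebesgue_rV_linear uM (@measurable_rV_box R n 1) (@measurable_eball R n 1).
rewrite lebesgue_rV_box// mulr1.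
have -> : (fun x : 'rV[R]_n => x *m r^-1%:M) @^-1` eball 1 = eball r.
  apply/seteqP; split => x /=; rewrite /eball /= mul_mx_scalar enormZ;
  by rewrite gtr0_norm ?invr_gt0// mulrC ler_pdivrMr// mul1r.
have -> : (fun x : 'rV[R]_n => - (x *m r^-1%:M)) @^-1`
    rV_box 1 = rV_box r.
  apply/seteqP; split => x /= h i; have := h i;
  by rewrite mul_mx_scalar !mxE normrN normrM gtr0_norm ?invr_gt0//;
    rewrite mulrC ler_pdivrMr// mul1r.
rewrite lebesgue_rV_box ?ltW// exprMn.
rewrite -(fineK (eball_fin_num n r)) -(fineK (eball_fin_num n 1)) -!EFinM => -[h].
congr EFin; apply: (mulfI (_ : (2 ^+ n : R) != 0)); first by rewrite expf_neq0.
by rewrite h; ring.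
Qed.

(** Here the test set is the unit ball: it is its own preimage under [M] and under [-M], and its
    volume, finite and positive, can be cancelled. *)
Lemma lebesgue_rV_isometry (R : realType) n (M : 'M[R]_n) (B : set (borel_rV R n)) :
  M *m M^T = 1%:M -> measurable B ->
  lebesgueB R n ((fun x : 'rV[R]_n => x *m M) @^-1` B) = lebesgueB R n B.
Proof.
move=> MM mB; have [uM _] := mulmx1_unit MM.
have := lebesgue_rV_linear uM (measurable_eball 1) mB.
rewrite muleC (_ : _ @^-1` eball 1 = eball 1); last first.
  apply/seteqP; split => x /=; rewrite /eball /= enormN !enorm_le//;
  by rewrite !dotpE trmx_mul mulmxA -(mulmxA x M) MM mulmx1.
have b0 : fine (lebesgueB R n (eball 1)) != 0.
  by rewrite gt_eqF// fine_gt0// eball1_gt0 /= -ge0_fin_numE// eball_fin_num.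
rewrite -(fineK (eball_fin_num n 1)) [RHS]muleC => h.
have bK x : ((fine (lebesgueB R n (eball 1)))^-1%:E *
    ((fine (lebesgueB R n (eball 1)))%:E * x) = x)%E.
  by rewrite muleA -EFinM mulVf// mul1e.
by rewrite -[LHS]bK -[RHS]bK; congr (_ * _)%E; rewrite muleC.
Qed.

(** * Trigonometric estimates *)

Section trigonometry.
Context {R : realType}.
Implicit Types x y t : R.

(** Applied three times in a row, this turns cos <= 1 into successive Taylor bounds of sin and
    cos. *)
Lemma le_is_derive_ge0 (f df : R -> R) :
  (forall x, is_derive x 1 f (df x)) -> (forall x, 0 <= x -> 0 <= df x) ->
  forall x, 0 <= x -> f 0 <= f x.
Proof.
move=> fE df0 x x0.
have der y : derivable f y 1 by exact: ex_derive.
apply: (@ger0_derive1_ndecry R f 0) => //.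
- move=> y; rewrite in_itv /= andbT => /ltW y0.
  by rewrite derive1E derive_val df0.
- by apply: derivable_within_continuous => y _; exact: der.
Qed.

Lemma sin_le x : 0 <= x -> sin x <= x.
Proof.
move=> x0; rewrite -subr_ge0.
have := @le_is_derive_ge0 (fun x => x - sin x) (fun x => 1 - cos x) _ _ x x0.
rewrite sin0 subr0; apply => y; last by move=> _; rewrite subr_ge0 cos_le1.
Qed.

Lemma cos_ge x : 0 <= x -> 1 - x ^+ 2 / 2 <= cos x.
Proof.
move=> x0.
have := @le_is_derive_ge0 (fun x => cos x + x ^+ 2 / 2) (fun x => - sin x + x) _ _ x x0.
rewrite cos0 expr0n /= mul0r addr0 => h; rewrite lerBlDr; apply: h => y.
  by apply: is_derive_eq; rewrite /GRing.scale /=; field.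
by move=> y0; rewrite addrC subr_ge0 sin_le.
Qed.

Lemma sin_ge x : 0 <= x -> x - x ^+ 3 / 6 <= sin x.
Proof.
move=> x0; rewrite -subr_ge0.
have := @le_is_derive_ge0 (fun x => sin x - (x - x ^+ 3 / 6))
  (fun x => cos x - (1 - x ^+ 2 / 2)) _ _ x x0.
rewrite sin0 expr0n /= mul0r !subr0; apply => y.
  by apply: is_derive_eq; rewrite /GRing.scale /=; field.
by move=> y0; rewrite subr_ge0 cos_ge.
Qed.

(** With s = sin (pi/6), the triple angle formula 3 s - 4 s^3 = 1 factors as (s + 1) (2 s - 1)^2 =
    0. *)
Lemma sin_pi6 : sin (pi / 6) = 1 / 2 :> R.
Proof.
have s0 : 0 < sin (pi / 6) :> R.
  by apply: sin_gt0_pi; have := @pi_gt0 R; lra.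
have := @sin_pihalf R.
have -> : pi / 2 = pi / 6 + (pi / 6 + pi / 6) :> R by field.
rewrite sinD cosD sinD => h.
have : (sin (pi / 6) + 1) * (2 * sin (pi / 6) - 1) ^+ 2 = 0 :> R.
  have h3 : 3 * cos (pi / 6) ^+ 2 * sin (pi / 6) - sin (pi / 6) ^+ 3 = 1 :> R.
    by apply: etrans h; ring.
  rewrite cos2sin2 in h3.
  transitivity (1 - (3 * (1 - sin (pi / 6) ^+ 2) * sin (pi / 6) - sin (pi / 6) ^+ 3) : R).
    by ring.
  by rewrite h3 subrr.
move/eqP; rewrite mulf_eq0 gt_eqF ?addr_gt0//= expf_eq0 /= subr_eq0 => /eqP h2.
by apply: (mulfI (_ : 2 != 0 :> R)) => //; rewrite h2; field.
Qed.

Lemma pi_ge3 : 3 <= pi :> R.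
Proof.
have := @sin_le (pi / 6); rewrite sin_pi6 => h.
by have := h (divr_ge0 (pi_ge0 R) (ler0n _ 6)); lra.
Qed.

(** Since 8/15 is a sixth of 16/5, it is enough that the cubic Taylor bound gives sin (8/15) >
    1/2. *)
Lemma pi_le_16_5 : pi <= 16 / 5 :> R.
Proof.
rewrite leNgt; apply/negP => h.
have : sin (8 / 15) < sin (pi / 6) :> R.
  by rewrite ltr_sin ?in_itv /=; [lra|apply/andP; split; lra..].
have := @sin_ge (8 / 15); rewrite sin_pi6; lra.
Qed.

End trigonometry.

(** * Plane geometry of the cap *)

Section cap_trigonometry.
Context {R : realType}.
Implicit Types x y r e : R.

Lemma cos2B x y : cos x ^+ 2 - cos y ^+ 2 = sin (y - x) * sin (y + x) :> R.
Proof.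
rewrite sinB sinD.
transitivity ((sin y ^+ 2) * (cos x ^+ 2) - (cos y ^+ 2) * (sin x ^+ 2)); last by ring.
by rewrite !sin2cos2; ring.
Qed.

(** For t beyond pi/2 the bound has to survive sin (2 r) = 2 sin r cos r, which vanishes as r tends
    to pi/2. The factor cos^2 r costs nothing: in [cap_depth] the quantity to be beaten, the
    contribution of the directions orthogonal to the plane, carries the same factor. *)
Lemma sin_ge_half r t : 0 < r < pi / 2 -> r / 2 <= t <= 2 * r ->
  cos r ^+ 2 * sin (r / 2) <= sin t.
Proof.
move=> /andP[r0 rpi] /andP[rt tr].
have s0 : 0 < sin (r / 2) by apply: sin_gt0_pi; have := @pi_gt0 R; lra.
have c0 : 0 < cos r by apply: cos_gt0_pihalf; have := @pi_gt0 R; lra.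
have c1 := cos_le1 r.
have cs : cos r ^+ 2 * sin (r / 2) <= sin (r / 2).
  by rewrite ler_piMl ?(ltW s0)// expr_le1// ltW.
have [tpi|tpi] := leP t (pi / 2).
  apply: le_trans cs _; rewrite leNgt ltr_sin ?in_itv /= -?leNgt//.
    by apply/andP; split; lra.
  by apply/andP; split; lra.
have -> : sin t = sin (pi - t) by rewrite sinB sinpi cospi; ring.
apply: (@le_trans _ _ (sin (2 * r))); last first.
  have -> : sin (2 * r) = sin (pi - 2 * r) by rewrite sinB sinpi cospi; ring.
  rewrite leNgt ltr_sin ?in_itv /= -?leNgt; first by lra.
    by apply/andP; split; lra.
  by apply/andP; split; lra.
have -> : sin (2 * r) = 2 * (cos r * sin r).
  by rewrite (_ : 2 * r = r + r); [rewrite sinD; ring|ring].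
have sr : sin (r / 2) <= sin r.
  rewrite leNgt ltr_sin ?in_itv /= -?leNgt; first by lra.
    by apply/andP; split; lra.
  by apply/andP; split; lra.
have : cos r ^+ 2 * sin (r / 2) <= cos r * sin r.
  apply: ler_pM => //; [exact: sqr_ge0|exact: ltW|].
  by rewrite expr2 ler_piMr ?(ltW c0).
have : 0 <= cos r * sin r by apply: mulr_ge0; [exact: ltW|apply: le_trans sr; exact: ltW].
lra.
Qed.

(* Polar coordinates in the plane: [b / p] is the tangent of a small angle psi,
   and [p cos x - b sin x], [p sin x + b cos x] are the coordinates of (p, b)
   after a rotation of angle x. *)
Lemma cap_depth r e p b : 0 < r < pi / 2 -> 0 < e <= 1 -> e <= 2 * r ->
  1 / 2 <= p -> `|b| <= p * sin (e / 4) ->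
  let s := p * cos (r - e / 2) - b * sin (r - e / 2) in
  0 < s /\
  cos r ^+ 2 * (1 / 4 * sin (e / 4) * sin (r / 2)) <=
    s ^+ 2 - cos r ^+ 2 * (p ^+ 2 + b ^+ 2).
Proof.
move=> /[dup] rr /andP[r0 rpi] /andP[e0 e1] er p2 bp s.
have p0 : 0 < p by lra.
have pi3 := @pi_ge3 R.
have se : 0 < sin (e / 4) by apply: sin_gt0_pi; apply/andP; split; lra.
have sr : 0 < sin (r / 2) by apply: sin_gt0_pi; apply/andP; split; lra.
have ce : 0 < cos (e / 4) by apply: cos_gt0_pihalf; apply/andP; split; lra.
(* The polar radius of (p, b) is [p / cos psi], so [s] is that radius times the cosine of
   [r - e / 2 + psi]. The hypothesis on [b] and sin <= tan give |psi| <= e/4. *)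
pose psi := atan (b / p).
have bE : b = p * tan psi by rewrite /psi atanK; field; rewrite gt_eqF.
have tane : sin (e / 4) <= tan (e / 4).
  by rewrite /tan ler_pdivlMr// ler_piMr ?(ltW se)// cos_le1.
have ein : - (pi / 2) < e / 4 < pi / 2 by apply/andP; split; lra.
have /andP[psi1 psi2] : - (e / 4) <= psi <= e / 4.
  have : `|b / p| <= tan (e / 4).
    by rewrite normrM normfV (gtr0_norm p0) ler_pdivrMr// mulrC (le_trans bp)// ler_pM2l.
  rewrite ler_norml -tanN => /andP[h1 h2]; apply/andP; split.
    by rewrite -(@tanK _ (- (e / 4))) ?le_atan// in_itv /=; apply/andP; split; lra.
  by rewrite -(@tanK _ (e / 4)) ?le_atan// in_itv /=.
have cpsi : 0 < cos psi by apply: cos_gt0_pihalf; apply/andP; split; lra.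
have cpsi1 := cos_le1 psi.
have sE : s = p / cos psi * cos (r - e / 2 + psi).
  by rewrite /s bE /tan (cosD (r - e / 2) psi); field; rewrite gt_eqF.
have pE : p ^+ 2 + b ^+ 2 = (p / cos psi) ^+ 2.
  transitivity (p ^+ 2 * (1 + tan psi ^+ 2)); first by rewrite bE; ring.
  by rewrite -cos2_tan2 ?gt_eqF// exprMn exprVn.
split.
  rewrite sE mulr_gt0 ?divr_gt0//; apply: cos_gt0_pihalf; apply/andP; split; lra.
have -> : s ^+ 2 - cos r ^+ 2 * (p ^+ 2 + b ^+ 2) =
    (p / cos psi) ^+ 2 * (cos (r - e / 2 + psi) ^+ 2 - cos r ^+ 2).
  by rewrite sE pE; ring.
rewrite cos2B.
(* The difference of the angles is e/2 - psi, hence at least e/4. *)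
have h1 : sin (e / 4) <= sin (r - (r - e / 2 + psi)).
  rewrite leNgt ltr_sin ?in_itv /= -?leNgt; first by lra.
    by apply/andP; split; lra.
  by apply/andP; split; lra.
(* The sum of the angles is at least 2 r - 3/4 e, and e <= 2 r makes this at least r/2. *)
have h2 : cos r ^+ 2 * sin (r / 2) <= sin (r + (r - e / 2 + psi)).
  by apply: sin_ge_half => //; apply/andP; split; lra.
have h3 : 1 / 4 <= (p / cos psi) ^+ 2.
  have : 1 / 2 <= p / cos psi by rewrite ler_pdivlMr//; nra.
  move=> h; nra.
have h4 : 0 <= cos r ^+ 2 * sin (r / 2) by rewrite mulr_ge0 ?sqr_ge0 ?ltW.
have h5 := ler_pM (ltW se) h4 h1 h2.
have h6 := ler_pM (_ : 0 <= 1 / 4) (mulr_ge0 (ltW se) h4) h3 h5.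
apply: le_trans (h6 _); last by lra.
by rewrite le_eqVlt; apply/orP; left; apply/eqP; ring.
Qed.

(** For t the angle between e0 and y, this expression is <x, y>, and it equals p sin y + b cos y
    with y the local angle t + (r - e/2) - pi/2. The bounds on t put y - e/4 and y + e/4 in [0, pi].
    The worst b is opposite in sign to cos y; with |b| <= p tan (e/4), nonnegativity reduces to that
    of sin (y - e/4) or of sin (y + e/4), according to the sign of cos y. *)
Lemma cap_side r e t p b : 0 < r < pi / 2 -> 0 < e <= 1 ->
  pi / 2 - r + 3 / 4 * e <= t <= pi / 2 + r ->
  0 < p -> `|b| <= p * sin (e / 4) ->
  0 <= sin t * (p * sin (r - e / 2) + b * cos (r - e / 2)) -
       cos t * (p * cos (r - e / 2) - b * sin (r - e / 2)).
Proof.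
move=> /andP[r0 rpi] /andP[e0 e1] /andP[t1 t2] p0.
have pi3 := @pi_ge3 R.
set y := t + (r - e / 2) - pi / 2; rewrite ler_norml => /andP[b1 b2].
have -> : sin t * (p * sin (r - e / 2) + b * cos (r - e / 2)) -
       cos t * (p * cos (r - e / 2) - b * sin (r - e / 2)) = p * sin y + b * cos y.
  rewrite /y sinBpihalf cosBpihalf (cosD t) (sinD t); ring.
have se : 0 < sin (e / 4) by apply: sin_gt0_pi; apply/andP; split; lra.
have ce : 0 < cos (e / 4) by apply: cos_gt0_pihalf; apply/andP; split; lra.
have ce1 := cos_le1 (e / 4).
have h1 : 0 <= sin (y - e / 4) by apply: sin_ge0_pi; rewrite /y; apply/andP; split; lra.
have h2 : 0 <= sin (y + e / 4) by apply: sin_ge0_pi; rewrite /y; apply/andP; split; lra.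
move: h1 h2; rewrite (sinB y) (sinD y) => h1 h2.
rewrite -(pmulr_rge0 _ ce) mulrDr.
have [cy|cy] := leP 0 (cos y).
  have : 0 <= p * (sin y * cos (e / 4) - cos y * sin (e / 4)) by rewrite mulr_ge0// ltW.
  have : 0 <= cos y * cos (e / 4) * (b + p * sin (e / 4)).
    by apply: mulr_ge0; [apply: mulr_ge0 => //; exact: ltW|lra].
  have : 0 <= cos y * (p * sin (e / 4)) * (1 - cos (e / 4)).
    apply: mulr_ge0; last by lra.
    by apply: mulr_ge0 => //; apply: mulr_ge0; exact: ltW.
  lra.
have : 0 <= p * (sin y * cos (e / 4) + cos y * sin (e / 4)) by rewrite mulr_ge0// ltW.
have : 0 <= (- cos y) * cos (e / 4) * (p * sin (e / 4) - b).
  by apply: mulr_ge0; [apply: mulr_ge0; [lra|exact: ltW]|lra].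
have : 0 <= (- cos y) * (p * sin (e / 4)) * (1 - cos (e / 4)).
  apply: mulr_ge0; last by lra.
  by apply: mulr_ge0; [lra|apply: mulr_ge0; exact: ltW].
lra.
Qed.

End cap_trigonometry.

(** * Boxes in an orthonormal frame *)

Section orthogonal_frame.
Context {R : realType}.

Lemma dotp_mulmx n (M : 'M[R]_n) (x y : 'rV[R]_n) :
  M *m M^T = 1%:M -> dotp (x *m M) (y *m M) = dotp x y.
Proof. by move=> MM; rewrite !dotpE trmx_mul mulmxA -(mulmxA x M) MM mulmx1. Qed.

Lemma dotp_delta n (x : 'rV[R]_n) i : dotp x (delta_mx 0 i) = x 0 i.
Proof.
rewrite /dotp (bigD1 i) //= mxE !eqxx mulr1 big1 ?addr0// => j ji.
by rewrite mxE eqxx (negbTE ji) mulr0.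
Qed.

(* The Householder reflection exchanging u and v. *)
Lemma reflection_exists n (u v : 'rV[R]_n) : dotp u u = 1 -> dotp v v = 1 ->
  exists M : 'M[R]_n, [/\ M *m M^T = 1%:M, u *m M = v &
    forall x, dotp x u = 0 -> dotp x v = 0 -> x *m M = x].
Proof.
move=> u1 v1; have [->|uv] := eqVneq u v.
  by exists 1%:M; split=> [||x _ _]; rewrite ?trmx1 mulmx1.
pose w := u - v; pose c := 2 / dotp w w.
have ww : dotp w w != 0 by rewrite dotp_eq0 subr_eq0.
pose M := 1%:M - c *: (w^T *m w).
have ME x : x *m M = x - (c * dotp x w) *: w.
  rewrite /M mulmxBr mulmx1 -scalemxAr mulmxA (mx11_scalar (x *m w^T)) -dotpE.
  by rewrite mul_scalar_mx scalerA.
have MT : M^T = M by rewrite /M linearB /= trmx1 linearZ /= trmx_mul trmxK.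
exists M; split.
- rewrite MT; apply/row_matrixP => i; rewrite rowE mulmxA rowE mulmx1.
  move: (delta_mx 0 i) => x; rewrite !ME.
  have -> : c * dotp (x - (c * dotp x w) *: w) w = - (c * dotp x w).
    by rewrite dotpBl dotpZl /c; field.
  by rewrite scaleNr opprK subrK.
- have wE : dotp w w = 2 * dotp u w.
    by rewrite !(dotpBl, dotpBr) (dotpC v u) u1 v1; ring.
  have uw : dotp u w != 0 by move: ww; rewrite wE mulf_eq0 negb_or => /andP[].
  have -> : u *m M = u - w.
    by rewrite ME (_ : c * dotp u w = 1) ?scale1r// /c wE; field.
  by rewrite /w opprB addrC subrK.
by move=> x xu xv; rewrite ME dotpBr xu xv subr0 mulr0 scale0r subr0.
Qed.

(** Two reflections: one takes [p] to the first basis vector, the other takes the image of [q] to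
    the second. The second one fixes the first basis vector, which is orthogonal to both vectors it
    exchanges. *)
Lemma orthonormal_frame m (p q : 'rV[R]_m.+2) :
  dotp p p = 1 -> dotp q q = 1 -> dotp p q = 0 ->
  exists M : 'M[R]_m.+2, M *m M^T = 1%:M /\
    forall x, (x *m M) 0 ord0 = dotp x p /\ (x *m M) 0 (lift ord0 ord0) = dotp x q.
Proof.
move=> p1 q1 pq.
pose e0 : 'rV[R]_m.+2 := delta_mx 0 ord0.
pose e1 : 'rV[R]_m.+2 := delta_mx 0 (lift ord0 ord0).
have e00 : dotp e0 e0 = 1 by rewrite dotp_delta mxE !eqxx.
have e11 : dotp e1 e1 = 1 by rewrite dotp_delta mxE !eqxx.
have e01 : dotp e0 e1 = 0 by rewrite dotp_delta mxE.
have [M1 [MM1 pM1 _]] := reflection_exists p1 e00.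
have q1' : dotp (q *m M1) (q *m M1) = 1 by rewrite dotp_mulmx.
have [M2 [MM2 qM2 fM2]] := reflection_exists q1' e11.
have MM : (M1 *m M2) *m (M1 *m M2)^T = 1%:M.
  by rewrite trmx_mul mulmxA -(mulmxA M1) MM2 mulmx1.
have pM : p *m (M1 *m M2) = e0.
  by rewrite mulmxA pM1 fM2 // -pM1 dotp_mulmx.
have qM : q *m (M1 *m M2) = e1 by rewrite mulmxA.
exists (M1 *m M2); split => // x.
by rewrite -!dotp_delta -/e0 -/e1 -pM -qM !dotp_mulmx.
Qed.

End orthogonal_frame.

Section box_volume.
Context {R : realType} {m : nat}.
Variables (p q : 'rV[R]_m.+2) (l h B Z : R).
Hypotheses (p1 : dotp p p = 1) (q1 : dotp q q = 1) (pq : dotp p q = 0).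

(** The last expression is the squared length of the component of [x] orthogonal to [p] and [q]; in
    this form no basis of the complement has to be chosen. *)
Definition frame_box : set (borel_rV R m.+2) :=
  [set x | [/\ l <= dotp (x : 'rV[R]_m.+2) p <= h, `|dotp (x : 'rV[R]_m.+2) q| <= B &
    dotp x x - dotp x p ^+ 2 - dotp (x : 'rV[R]_m.+2) q ^+ 2 <= Z ^+ 2]].

Let cdotp (w : 'rV[R]_m.+2) :
  measurable_fun [set: borel_rV R m.+2] (fun x : 'rV[R]_m.+2 => dotp x w).
Proof.
apply: continuous_measurable_rV; apply: (@continuous_dotp _ _ _ idfun (cst w)) => x.
  exact: cvg_id.
exact: cst_continuous.
Qed.

Lemma measurable_frame_box : measurable frame_box.
Proof.
have mle (f : 'rV[R]_m.+2 -> R) (i : interval R) :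
    measurable_fun [set: borel_rV R m.+2] f ->
    measurable ([set x | f x \in i] : set (borel_rV R m.+2)).
  by move=> mf; exact: (measurable_preimageT mf (measurable_itv i)).
have -> : frame_box = [set x | dotp x p \in `[l, h]] `&`
    ([set x | `|dotp x q| \in `]-oo, B]] `&`
    [set x | dotp x x - dotp x p ^+ 2 - dotp x q ^+ 2 \in `]-oo, Z ^+ 2]]).
  apply/seteqP; split => x; rewrite /frame_box /= !in_itv /=; first by case.
  by case=> ? [].
apply: measurableI; [exact: mle|apply: measurableI; apply: mle].
  exact: measurableT_comp.
apply: measurable_funB; first apply: measurable_funB.
- apply: continuous_measurable_rV; apply: (@continuous_dotp _ _ _ idfun idfun) => x;
  exact: cvg_id.
- exact: measurable_funX.
- exact: measurable_funX.
Qed.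

Lemma lebesgue_frame_box : l <= h -> 0 <= B -> 0 < Z ->
  lebesgueB R m.+2 frame_box =
  (((h - l) * (2 * B) * Z ^+ m)%:E * lebesgueB R m (eball 1))%E.
Proof.
move=> lh B0 Z0; have [M [MM Mpq]] := orthonormal_frame p1 q1 pq.
pose S : set (borel_rV R m.+2) := [set y | [/\ l <= (y : 'rV[R]_m.+2) 0 ord0 <= h,
  `|(y : 'rV[R]_m.+2) 0 (lift ord0 ord0)| <= B &
   dotp y y - (y : 'rV[R]_m.+2) 0 ord0 ^+ 2 -
     (y : 'rV[R]_m.+2) 0 (lift ord0 ord0) ^+ 2 <= Z ^+ 2]].
have SE : frame_box = (fun x : 'rV[R]_m.+2 => x *m M) @^-1` S.
  by apply/seteqP; split => x; rewrite /frame_box /S /= dotp_mulmx//;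
    have [-> ->] := Mpq x.
have mS : measurable S.
  have -> : S = (fun y : 'rV[R]_m.+2 => y *m M^T) @^-1` frame_box.
    by apply/seteqP; split => y; rewrite SE /= -mulmxA (mulmx1C MM) mulmx1.
  exact: (measurable_preimageT (measurable_rVM M^T) measurable_frame_box).
rewrite SE lebesgue_rV_isometry //.
pose S1 : set (borel_rV R m.+1) := [set w | `|(w : 'rV[R]_m.+1) 0 ord0| <= B /\
   dotp w w - (w : 'rV[R]_m.+1) 0 ord0 ^+ 2 <= Z ^+ 2].
rewrite (@lebesgue_rV_setX _ _ `[l, h]%classic S1) //; last first.
  move=> x v; rewrite /S /S1 /= in_itv /= !row_mx_head !row_mx_tail dotp_row_mx.
  have -> : x * x + dotp v v - x ^+ 2 - v 0 ord0 ^+ 2 = dotp v v - v 0 ord0 ^+ 2.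
    by ring.
  by split => [[? ? ?]|[? [? ?]]].
rewrite (@lebesgue_rV_setX _ _ `[- B, B]%classic (eball Z)) //; last first.
  move=> x v; rewrite /S1 /= in_itv /= !row_mx_head dotp_row_mx -ler_norml.
  rewrite /eball /= enorm_le ?(ltW Z0)//.
  by have -> : x * x + dotp v v - x ^+ 2 = dotp v v by ring.
rewrite eball_scale // !lebesgue_measure_itv /= !lte_fin !muleA -!EFinD.
have <- : B - - B = 2 * B by ring.
case: ltP => [_|hl]; last first.
  have -> : h - l = 0 by lra.
  by rewrite !mul0r !mul0e.
case: ltP => [_|hB]; first by rewrite -!EFinM.
have -> : B - - B = 0 by lra.
by rewrite mule0 mulr0 mul0r !mul0e.
Qed.

End box_volume.

(** * Spherical convexity *)

Section spherical_geometry.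
Context {R : realType} {d : nat}.
Implicit Types (x y z v e : 'rV[R]_d.+1) (C K : set 'rV[R]_d.+1) (a r s : R).

Lemma sphere_dotp x : sphere d x -> dotp x x = 1.
Proof. by move=> x1; rewrite -sqr_enorm x1 expr1n. Qed.

Lemma in_sball e y r : sphere d e -> sphere d y -> 0 <= r <= pi ->
  sball e r y <-> cos r <= dotp e y.
Proof.
move=> e1 y1 /andP[r0 rpi]; have b := dotp_unit_bound e1 y1.
rewrite -[dotp e y in X in _ <-> X](@acosK R) ?in_itv//.
have ain : acos (dotp e y) \in `[0, pi] by rewrite in_itv /= acos_ge0// acos_lepi.
have rin : r \in `[0, pi] by rewrite in_itv /= r0.
rewrite leNgt ltr_cos// -leNgt; split => [[]//|h]; by split.
Qed.

Lemma sball_le e r s : r <= s -> sball e r `<=` sball e s.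
Proof. by move=> rs y [y1 yr]; split => //; apply: le_trans rs. Qed.

Lemma normalize_sphere x : x != 0 -> sphere d ((enorm x)^-1 *: x).
Proof.
move=> x0; have := x0; rewrite -enorm_gt0 => n0.
by rewrite /sphere /= enormZ gtr0_norm ?invr_gt0// mulVf// gt_eqF.
Qed.

Section cone.
Variable C : set 'rV[R]_d.+1.
Hypothesis coneC : convex_cone C.

Lemma cone_scale t x : 0 <= t -> C x -> C (t *: x).
Proof. by case: coneC => _ h _ t0 Cx; exact: h. Qed.

Lemma cone_add x y : C x -> C y -> C (x + y).
Proof.
case: coneC => _ h cv Cx Cy.
have -> : x + y = 2 *: (2^-1 *: x + 2^-1 *: y).
  by rewrite scalerDr !scalerA mulfV ?pnatr_eq0// !scale1r.
apply: h => //.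
have h0 : 0 <= 2^-1 :> R by lra.
have h1 : 2^-1 <= 1 :> R by lra.
have := cv x y (Itv01 h0 h1) (mem_set Cx) (mem_set Cy).
rewrite inE /conv /=; congr C; congr (_ + _ *: _).
by rewrite /unstable.onem; field.
Qed.

End cone.

(* The spherical form of: a vector at angle more than pi/2 + a from e is at
   angle more than pi/2 from every vector at angle at most a from e. *)
Lemma dotp_lt0_sball e x v a : 0 < a < pi / 2 -> sphere d e -> sphere d v ->
  cos a <= dotp e v -> dotp x e < 0 -> sin a ^+ 2 * dotp x x < dotp x e ^+ 2 ->
  dotp x v < 0.
Proof.
move=> /andP[a0 api] /sphere_dotp e1 /sphere_dotp v1 ev xe sxe.
have ca : 0 < cos a by apply: cos_gt0_pihalf; apply/andP; split; lra.
set al := dotp e v in ev *; set xi := - dotp x e.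
have xi0 : 0 < xi by rewrite oppr_gt0.
(* These are the components of [x] and [v] orthogonal to [e]: Cauchy-Schwarz there shows that <x, v>
   is too close to - al xi to be nonnegative. *)
have := dotp_CauchySchwarz (x + xi *: e) (v - al *: e).
have -> : dotp (x + xi *: e) (v - al *: e) = dotp x v + al * xi.
  rewrite !(dotpDl, dotpBr, dotpZl, dotpZr) e1 -/al -[dotp x e]opprK -/xi; ring.
have -> : dotp (x + xi *: e) (x + xi *: e) = dotp x x - xi ^+ 2.
  rewrite !(dotpDl, dotpDr, dotpZl, dotpZr) (dotpC e x) e1 -[dotp x e]opprK -/xi; ring.
have -> : dotp (v - al *: e) (v - al *: e) = 1 - al ^+ 2.
  rewrite !(dotpBl, dotpBr, dotpZl, dotpZr) (dotpC v e) -/al v1 e1; ring.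
move=> h.
have al0 : 0 < al by apply: lt_le_trans ev.
have hx : sin a ^+ 2 * dotp x x < xi ^+ 2 by rewrite /xi sqrrN.
have al2 : cos a ^+ 2 <= al ^+ 2 by rewrite ler_sqr ?nnegrE// ltW.
have hc := cos2sin2 a.
have xx0 : 0 <= dotp x x - xi ^+ 2.
  have := dotp_CauchySchwarz x e; rewrite e1 mulr1 /xi sqrrN; lra.
have h2 : (dotp x x - xi ^+ 2) * (1 - al ^+ 2) < (al * xi) ^+ 2.
  apply: (@le_lt_trans _ _ ((dotp x x - xi ^+ 2) * sin a ^+ 2)).
    by apply: ler_wpM2l => //; lra.
  apply: (@lt_le_trans _ _ (cos a ^+ 2 * xi ^+ 2)); first by rewrite hc; lra.
  by rewrite exprMn ler_wpM2r ?sqr_ge0.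
have h3 : (dotp x v + al * xi) ^+ 2 < (al * xi) ^+ 2 by apply: le_lt_trans h2.
have axi : 0 < al * xi by rewrite mulr_gt0.
rewrite ltNge; apply/negP => xv.
move: h3; rewrite ltNge => /negP; apply.
by rewrite ler_sqr ?nnegrE ?(ltW axi)//; lra.
Qed.

(** The vector <x, y> e - <x, e> y is a combination of [e] and [y] with nonnegative coefficients,
    and is orthogonal to [x]. It could vanish only for y = -e, which [-1 < dotp e y] excludes. *)
Lemma cone_orthogonal C x e y : convex_cone C -> C e -> C y ->
  sphere d e -> sphere d y -> -1 < dotp e y ->
  dotp x e < 0 -> 0 <= dotp x y ->
  orthocomp x `&` (sphere d `&` C) !=set0.
Proof.
move=> coneC Ce Cy /sphere_dotp e1 /sphere_dotp y1 ey xe xy.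
pose v := dotp x y *: e + (- dotp x e) *: y.
have Cv : C v by apply: cone_add => //; apply: cone_scale => //; lra.
have xv : dotp x v = 0 by rewrite dotpDr !dotpZr; ring.
have v0 : v != 0.
  apply/eqP => v0.
  have h1 : dotp v e = 0 by rewrite v0 dotpE mul0mx mxE.
  have h2 : dotp v y = 0 by rewrite v0 dotpE mul0mx mxE.
  move: h1 h2; rewrite !(dotpDl, dotpZl) (dotpC y e) e1 y1 !mulr1 => h1 h2.
  have h3 : (dotp x y - dotp x e) * (1 + dotp e y) = 0 by lra.
  by move/eqP: h3; rewrite mulf_eq0 => /orP[/eqP|/eqP]; lra.
exists ((enorm v)^-1 *: v); split; last split.
- by rewrite /orthocomp /= dotpZr xv mulr0.
- exact: normalize_sphere.
- by apply: cone_scale; rewrite ?invr_ge0 ?enorm_ge0.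
Qed.

(* If y were closer than a to -e then -y would be an interior point of C, so
   that C, containing y as well, would be the whole space. *)
Lemma sconvex_angle_le C a e y : convex_cone C -> ~ linear_subspace C ->
  0 < a <= pi / 2 -> sphere d e -> sball e a `<=` sphere d `&` C ->
  sphere d y -> C y -> acos (dotp e y) <= pi - a.
Proof.
move=> coneC nlin /andP[a0 api] e1 ballC y1 Cy; rewrite leNgt; apply/negP => ey.
apply: nlin; exists fullv; apply/seteqP; split => [v _|v _]; first by rewrite /= memvf.
have pi0 := @pi_gt0 R.
have b := dotp_unit_bound e1 y1.
have cy : cos a < - dotp e y.
  have : cos (acos (dotp e y)) < cos (pi - a).
    rewrite ltr_cos ?in_itv /= ?acos_ge0 ?acos_lepi//; apply/andP; split; lra.
  by rewrite acosK ?in_itv// cosB cospi sinpi; lra.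
have c0 : 0 <= cos a by apply: cos_ge0_pihalf; apply/andP; split; lra.
have [->|v0] := eqVneq v 0.
  by rewrite -(scale0r y); apply: cone_scale.
have nv : 0 < enorm v by rewrite enorm_gt0.
(* The perturbation [t *: v] of [- y] costs at most t |v| in <e, w> and as much in |w|; half of the
   slack for each keeps [w] within angle [a] of [e]. *)
pose t := (- dotp e y - cos a) / (2 * enorm v).
have t0 : 0 < t by rewrite divr_gt0 ?mulr_gt0//; lra.
pose w := - y + t *: v.
have tv : t * enorm v = (- dotp e y - cos a) / 2.
  by rewrite /t; field; rewrite gt_eqF.
have ew : cos a * enorm w <= dotp e w.
  have h1 : enorm w <= 1 + t * enorm v.
    have tn : 0 <= t * enorm v by rewrite mulr_ge0 ?ltW.
    rewrite enorm_le ?addr_ge0// !(dotpDl, dotpDr, dotpZl, dotpZr).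
    rewrite !(dotpNl, dotpNr) (dotpC v y) (sphere_dotp y1) -sqr_enorm.
    have := dotp_le (- y) v; rewrite dotpNl enormN y1 mul1r => h.
    have : 0 <= t * (enorm v + dotp y v) by rewrite mulr_ge0 ?(ltW t0)//; lra.
    lra.
  have h2 : dotp e w = - dotp e y + t * dotp e v.
    by rewrite dotpDr dotpNr dotpZr.
  have h3 : - (t * enorm v) <= t * dotp e v.
    have := dotp_le (- e) v; rewrite dotpNl enormN e1 mul1r => h.
    by rewrite -mulrN ler_wpM2l ?(ltW t0)//; lra.
  have h4 : cos a * enorm w <= cos a * (1 + t * enorm v) by rewrite ler_wpM2l.
  have h5 := cos_le1 a.
  have h6 : cos a * (t * enorm v) <= t * enorm v.
    by apply: ler_piMl => //; apply: mulr_ge0; exact: ltW.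
  by rewrite h2; lra.
have w0 : w != 0.
  apply/eqP => w0; have : dotp w e = 0 by rewrite w0 dotpE mul0mx mxE.
  have := dotp_le e v; rewrite e1 mul1r => hv.
  rewrite dotpC dotpDr dotpNr dotpZr.
  have h3 : - (t * enorm v) <= t * dotp e v.
    have := dotp_le (- e) v; rewrite dotpNl enormN e1 mul1r => h.
    by rewrite -mulrN ler_wpM2l ?(ltW t0)//; lra.
  by lra.
have nw : 0 < enorm w by rewrite enorm_gt0.
have Cw : C w.
  have [_] : (sphere d `&` C) ((enorm w)^-1 *: w).
    apply/ballC/in_sball => //; [exact: normalize_sphere|apply/andP; split; lra|].
    by rewrite dotpZr mulrC ler_pdivlMr.
  move=> /(cone_scale coneC (ltW nw)).
  by rewrite scalerA mulfV ?scale1r// gt_eqF.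
have -> : v = t^-1 *: (y + w).
  by rewrite /w addrA subrr add0r scalerA mulVf ?scale1r// gt_eqF.
by apply: cone_scale => //; [rewrite invr_ge0 ltW|exact: cone_add].
Qed.

(** A point [z] of the boundary is the limit of z + t e as t > 0 tends to 0; these directions are at
    angle less than [a] from [e], hence in the closed cone. It makes up for the supremum in
    [inradius_at] not being known to be attained. *)
Lemma sball_sub_closed C a e : closed C -> convex_cone C -> C e -> sphere d e ->
  0 < a <= pi / 2 ->
  (forall r, 0 <= r < a -> sball e r `<=` sphere d `&` C) ->
  sball e a `<=` sphere d `&` C.
Proof.
move=> clC coneC Ce e1 /andP[a0 api] sub z za; have [z1 _] := za; split => //.
have pi0 := @pi_gt0 R.
have arange : 0 <= a <= pi by apply/andP; split; lra.
have {}za := (in_sball e1 z1 arange).1 za.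
have ca : 0 <= cos a by apply: cos_ge0_pihalf; apply/andP; split; lra.
have ee := sphere_dotp e1; have zz := sphere_dotp z1.
set al := dotp e z in za; have al0 : 0 <= al by lra.
have [al1|al1] := leP 1 al.
  suff -> : z = e by [].
  apply/eqP; rewrite -subr_eq0 -dotp_eq0 eq_le dotp_ge0 andbT.
  by rewrite !(dotpBl, dotpBr) (dotpC z e) -/al ee zz; lra.
have Czt t : 0 < t -> C (z + t *: e).
  move=> t0; pose w := z + t *: e.
  have we : dotp e w = al + t by rewrite dotpDr dotpZr ee mulr1.
  have ww : dotp w w = 1 + 2 * t * al + t ^+ 2.
    by rewrite !(dotpDl, dotpDr, dotpZl, dotpZr) (dotpC z e) -/al ee zz; ring.
  have w0 : w != 0.
    apply/eqP => w0; move: we; rewrite w0 dotpE trmx0 mulmx0 mxE; lra.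
  have nw : 0 < enorm w by rewrite enorm_gt0.
  have s1 := normalize_sphere w0.
  pose r := acos (dotp e ((enorm w)^-1 *: w)).
  have b := dotp_unit_bound e1 s1.
  have ra : 0 <= r < a.
    rewrite acos_ge0//= ltNge; apply/negP => ar.
    have : cos r <= cos a.
      rewrite leNgt ltr_cos ?in_itv /= -?leNgt ?acos_ge0 ?acos_lepi//.
    rewrite /r acosK ?in_itv// dotpZr we mulrC ler_pdivrMr// => h.
    have h1 : (al + t) ^+ 2 <= (al * enorm w) ^+ 2.
      have h2 : cos a * enorm w <= al * enorm w.
        by apply: ler_wpM2r => //; exact: ltW.
      rewrite ler_sqr ?nnegrE; [lra|lra|by apply: mulr_ge0 => //; exact: ltW].
    move: h1; rewrite exprMn sqr_enorm ww => h1.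
    have : 0 < (1 - al ^+ 2) * (t * (2 * al + t)).
      apply: mulr_gt0; last by apply: mulr_gt0 => //; lra.
      by rewrite subr_gt0 expr_lt1.
    lra.
  have [_] : (sphere d `&` C) ((enorm w)^-1 *: w).
    by apply: sub ra _ _; split.
  move=> /(cone_scale coneC (ltW nw)).
  by rewrite scalerA mulfV ?scale1r// gt_eqF.
have cz : (fun n => z + harmonic n *: e) @ \oo --> z.
  rewrite -[X in _ --> X]addr0 -(scale0r e); apply: cvgD; first exact: cvg_cst.
  by apply: cvgZr_tmp; exact: cvg_harmonic.
apply: (closed_cvg C) cz => //; near=> n; apply: Czt.
by rewrite /harmonic invr_gt0.
Unshelve. all: by end_near. Qed.

End spherical_geometry.

(** The depth available is at least 1/4 sin (eps/4) sin (r/2) for r = pi/2 - a, hence at least 1/4 *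
    49/200 * 2/5 * eps r = 0.0245 eps r; the factor 2/100 leaves a margin for a strict
    inequality. *)
Definition cap_radius {R : realType} (a eps : R) : R :=
  Num.sqrt (2 / 100 * (eps * (pi / 2 - a))).

Lemma cap_radius_gt0 (R : realType) (a eps : R) :
  0 < a < pi / 2 -> 0 < eps <= 1 -> 0 < cap_radius a eps.
Proof.
move=> /andP[a0 api] /andP[ep0 ep1].
by rewrite sqrtr_gt0 !mulr_gt0//; lra.
Qed.

(* The box is centred on the direction p bisecting the cap that y cuts off from
   the polar of the ball of centre e0 and radius a. *)
Lemma frame_box_cap (R : realType) m (e0 y : 'rV[R]_m.+2) (a eps : R) :
  sphere m.+1 e0 -> sphere m.+1 y -> 0 < a < pi / 2 -> 0 < eps <= 1 ->
  eps <= 2 * (pi / 2 - a) ->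
  a + 3 / 4 * eps <= acos (dotp e0 y) <= pi - a ->
  exists p q : 'rV[R]_m.+2,
  [/\ dotp p p = 1, dotp q q = 1, dotp p q = 0 &
    forall x : 'rV[R]_m.+2,
    frame_box p q (1 / 2) (97 / 100) (49 / 400 * eps) (cap_radius a eps) x ->
    [/\ 0 < enorm x <= 1, dotp x e0 < 0,
        sin a ^+ 2 * dotp x x < dotp x e0 ^+ 2 & 0 <= dotp x y]].
Proof.
move=> e01 y1 a_itv eps_itv eps_le y_angle.
pose r := pi / 2 - a.
have pi3 := @pi_ge3 R; have pi4 := @pi_le_16_5 R.
move: (a_itv) (eps_itv) (y_angle) => /andP[a0 api] /andP[ep0 ep1] /andP[th1 th2].
set th := acos (dotp e0 y) in th1 th2 *.
have cth : cos th = dotp e0 y by rewrite /th acosK// in_itv /= dotp_unit_bound.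
have sth : 0 < sin th by apply: sin_gt0_pi; apply/andP; split; lra.
have ee := sphere_dotp e01; have yy := sphere_dotp y1.
pose u := (sin th)^-1 *: (y - cos th *: e0).
have eu : dotp e0 u = 0 by rewrite dotpZr dotpBr dotpZr ee cth; ring.
have uu : dotp u u = 1.
  rewrite !(dotpZl, dotpZr, dotpBl, dotpBr) ee yy (dotpC y e0) -cth.
  have := sin2cos2 th => h.
  transitivity ((sin th) ^-2 * (1 - cos th ^+ 2)); first by field; rewrite gt_eqF.
  by rewrite -h mulVf// expf_neq0// gt_eqF.
have yE : y = cos th *: e0 + sin th *: u.
  by rewrite scalerA mulfV ?gt_eqF// scale1r addrC subrK.
clearbody u.
pose ph := r - eps / 2.
(* In the plane of [e0] and [y], [p] is the direction at angle [ph] from [- e0], turned towards [y],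
   and [q] is the derivative of [p] in [ph]. *)
pose p := - cos ph *: e0 + sin ph *: u; pose q := sin ph *: e0 + cos ph *: u.
have cs := cos2Dsin2 ph.
exists p, q; split.
- by rewrite /p !(dotpDl, dotpDr, dotpZl, dotpZr) (dotpC u e0) ee uu eu -[RHS]cs; ring.
- by rewrite /q !(dotpDl, dotpDr, dotpZl, dotpZr) (dotpC u e0) ee uu eu -[RHS]cs; ring.
- by rewrite /p /q !(dotpDl, dotpDr, dotpZl, dotpZr) (dotpC u e0) ee uu eu; ring.
move=> x [/andP[p_ge p_le] q_le z_le].
have xe : dotp x e0 = - (dotp x p * cos ph - dotp x q * sin ph).
  rewrite /p /q !(dotpDr, dotpZr) -[LHS]mul1r -[X in X * _ = _]cs; ring.
have xu : dotp x u = dotp x p * sin ph + dotp x q * cos ph.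
  rewrite /p /q !(dotpDr, dotpZr) -[LHS]mul1r -[X in X * _ = _]cs; ring.
have r0 : 0 < r by rewrite /r; lra.
have rpi : r < pi / 2 by rewrite /r; lra.
have se : 49 / 200 * eps <= sin (eps / 4).
  have h1 : 0 <= eps / 4 by lra.
  apply: le_trans (sin_ge h1).
  have h2 : eps ^+ 3 <= eps by rewrite exprS ler_piMr ?(ltW ep0)// expr_le1// ltW.
  have -> : (eps / 4) ^+ 3 = eps ^+ 3 / 64 by field.
  lra.
have sr : 2 / 5 * r <= sin (r / 2).
  have h1 : 0 <= r / 2 by lra.
  apply: le_trans (sin_ge h1).
  have h2 : r ^+ 3 <= r * (64 / 25).
    rewrite exprS ler_pM2l// -[64 / 25](_ : (8 / 5) ^+ 2 = _); last by field.
    by rewrite ler_sqr ?nnegrE; clear -r0 rpi pi4; lra.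
  have -> : (r / 2) ^+ 3 = r ^+ 3 / 8 by field.
  lra.
(* The half-width 49/400 eps is 49/200 eps times 1/2, the least value of <x, p> on the box. *)
have q_le' : `|dotp x q| <= dotp x p * sin (eps / 4).
  apply: (le_trans q_le); have h : 0 <= (dotp x p - 1 / 2) * sin (eps / 4).
    by apply: mulr_ge0; [|apply: le_trans se]; clear -p_ge ep0; lra.
  by clear -h se p_ge ep0; lra.
have rr : 0 < r < pi / 2 by rewrite r0.
have p0 : 0 < dotp x p by clear -p_ge; lra.
have [s0 sq] := cap_depth rr eps_itv eps_le p_ge q_le'.
have thr : pi / 2 - r + 3 / 4 * eps <= th <= pi / 2 + r.
  by apply/andP; split; rewrite /r; clear -th1 th2; lra.
have side := cap_side rr eps_itv thr p0 q_le'.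
have csa : cos r = sin a by rewrite /r cosB cos_pihalf sin_pihalf; ring.
have sa : 0 < sin a.
  by apply: sin_gt0_pi; apply/andP; split => //; clear -api pi3; lra.
have Z2 : cap_radius a eps ^+ 2 = 2 / 100 * (eps * r).
  rewrite sqr_sqrtr// mulr_ge0 ?mulr_ge0 ?(ltW ep0) ?(ltW r0)//.
rewrite Z2 in z_le.
have q2 : dotp x q ^+ 2 <= (49 / 400) ^+ 2 * eps ^+ 2.
  rewrite -exprMn -real_normK ?num_real//; apply: lerXn2r => //.
  by rewrite nnegrE; apply: le_trans q_le; exact: normr_ge0.
have ep2 : eps ^+ 2 <= 1 by rewrite expr_le1// ltW.
have er : eps * r <= 8 / 5.
  rewrite -[8 / 5]mul1r; apply: ler_pM => //; [exact: ltW|exact: ltW|].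
  by clear -rpi pi4; lra.
have p2 : dotp x p ^+ 2 <= (97 / 100) ^+ 2.
  by apply: lerXn2r => //; rewrite nnegrE; clear -p_ge p_le; lra.
split.
(* The bound 97/100 is what the unit ball allows: (97/100)^2 + (49/400)^2 + 2/100 * 8/5 < 1. *)
- rewrite enorm_gt0 enorm_le// expr1n; apply/andP; split.
    by apply/eqP => x0; move: p0; rewrite x0 dotpE mul0mx mxE ltxx.
  by clear -z_le q2 ep2 er p2; lra.
- by rewrite xe oppr_lt0.
- rewrite csa in sq; rewrite xe sqrrN.
  have h1 : 2 / 100 * (eps * r) < 1 / 4 * sin (eps / 4) * sin (r / 2).
    have h2 : (49 / 200 * eps) * (2 / 5 * r) <= sin (eps / 4) * sin (r / 2).
      have e1 : 0 <= 49 / 200 * eps by clear -ep0; lra.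
      have e2 : 0 <= 2 / 5 * r by clear -r0; lra.
      exact: ler_pM.
    have h3 : 0 < eps * r by rewrite mulr_gt0.
    by clear -h2 h3; lra.
  have h4 : sin a ^+ 2 * (2 / 100 * (eps * r)) <
      sin a ^+ 2 * (1 / 4 * sin (eps / 4) * sin (r / 2)).
    by rewrite ltr_pM2l// exprn_gt0.
  have h5 : sin a ^+ 2 * dotp x x <= sin a ^+ 2 *
      (2 / 100 * (eps * r) + dotp x p ^+ 2 + dotp x q ^+ 2).
    by apply: ler_wpM2l; [exact: sqr_ge0|clear -z_le; lra].
  by rewrite -/ph in sq; clear -sq h4 h5; lra.
have -> : dotp x y = sin th * dotp x u + cos th * dotp x e0.
  by rewrite {1}yE dotpDr !dotpZr addrC.
by rewrite xe xu mulrN.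
Qed.

(** A point beyond angle pi/2, or beyond pi - a, from an incentre would contradict
    [sconvex_angle_le]; as there are points at every angle below a + eps, this gives a < pi/2 and a
    + eps <= pi - a. *)
Lemma inradius_far_point (R : realType) (d : nat) (C : set 'rV[R]_d.+1) (a eps : R) :
  let K := sphere d `&` C in
  closed C -> convex_cone C -> ~ linear_subspace C ->
  0 < a -> a <= inradius K -> 0 < eps -> eps <= vartheta_r K ->
  [/\ a < pi / 2, eps <= 2 * (pi / 2 - a) &
   exists e0 y, [/\ K e0, sball e0 a `<=` K, K y &
     a + 3 / 4 * eps <= acos (dotp e0 y) <= pi - a]].
Proof.
move=> K clC coneC nlin a0 aK ep0 epK.
have pi0 := @pi_gt0 R.
pose D := [set e | K e /\ inradius_at K e = inradius K].
(* A set without infimum gets the value 0, which [0 < eps <= vartheta_r K] rules out. This is also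
   where the existence of an incentre comes from. *)
have hD : has_inf [set circumradius_at K e - inradius_at K e | e in D].
  by apply: contrapT => h; move: epK; rewrite /vartheta_r inf_out//; lra.
have [[_ [e0 [[e01 Ce0] e0K] _]] hlb] := hD.
have Ke0 : K e0 by [].
have far : a + eps <= circumradius_at K e0.
  have : vartheta_r K <= circumradius_at K e0 - inradius_at K e0.
    by apply: ge_inf => //; exists e0.
  by rewrite e0K; lra.
have near_ball r : 0 <= r < a -> sball e0 r `<=` K.
  move=> /andP[r0 ra].
  have rK : r < inradius_at K e0 by rewrite e0K; lra.
  have S0 : [set r | 0 <= r /\ sball e0 r `<=` K] !=set0.
    apply/set0P/eqP => S0; move: rK; rewrite /inradius_at S0 sup0; lra.
  have [s [_ sK] rs] := sup_gt S0 rK.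
  exact: subset_trans (sball_le (ltW rs)) sK.
have far_point r : 0 <= r < a + eps -> exists y, K y /\ r < acos (dotp e0 y).
  move=> /andP[r0 ra]; apply: contrapT => h.
  have : circumradius_at K e0 <= r; last by lra.
  apply: ge_inf; first by exists 0 => s [].
  split => // y Ky; split; first by case: Ky.
  by rewrite leNgt; apply/negP => ry; apply: h; exists y.
(* Stated for all b <= a because a <= pi/2 is not known yet; b = pi/2 will prove it. *)
have angle_le b y : 0 < b <= a -> b <= pi / 2 -> K y -> acos (dotp e0 y) <= pi - b.
  move=> /andP[b0 ba] bpi [y1 Cy].
  have bb : 0 < b <= pi / 2 by rewrite b0.
  apply: (sconvex_angle_le coneC nlin bb e01 _ y1 Cy).
  apply: (sball_sub_closed clC coneC Ce0 e01 bb) => s /andP[s0 sb].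
  by apply: near_ball; rewrite s0; lra.
have api : a < pi / 2.
  rewrite ltNge; apply/negP => pia.
  have [|y [Ky ya]] := far_point (pi / 2); first by apply/andP; split; lra.
  have := angle_le (pi / 2) y _ _ Ky; lra.
have epi : eps <= 2 * (pi / 2 - a).
  rewrite leNgt; apply/negP => h.
  have [|y [Ky ya]] := far_point (pi - a); first by apply/andP; split; lra.
  have := angle_le a y _ _ Ky; rewrite a0 lexx => /(_ isT (ltW api)); lra.
split => //.
have [|y [Ky ya]] := far_point (a + 3 / 4 * eps); first by apply/andP; split; lra.
exists e0, y; split => //.
  apply: sball_sub_closed => //; first by rewrite a0 ltW.
by rewrite (ltW ya) angle_le ?a0 ?lexx// ltW.
Qed.

(** * Spherical measure and [U1] *)

Lemma measurable_enorm (R : realType) n : measurable_fun [set: borel_rV R n] (@enorm R n).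
Proof. by apply: continuous_measurable_rV; exact: continuous_enorm. Qed.

Lemma measurable_cone_over (R : realType) d (A : set (borel_rV R d.+1)) :
  measurable A -> measurable (cone_over A : set (borel_rV R d.+1)).
Proof.
move=> mA.
have mh : measurable_fun [set: borel_rV R d.+1]
    (fun x : 'rV[R]_d.+1 => (enorm x)^-1 *: x : borel_rV R d.+1).
  apply: measurable_fun_rV => i.
  (* Measurability of the inverse is taken from that of real powers; at norm 0 both have the value
     0. *)
  have -> : (fun x : 'rV[R]_d.+1 => ((enorm x)^-1 *: x) 0 i) =
      (fun x : 'rV[R]_d.+1 => powR (enorm x) (-1) * x 0 i).
    by apply/funext => x; rewrite mxE powR_inv1// enorm_ge0.
  apply: measurable_funM; last exact: measurable_coord.
  exact: (@measurableT_comp _ _ _ (borel_rV R d.+1) R R (fun t => powR t (-1)) setT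
    (@enorm R d.+1) (@measurable_powR R _) (@measurable_enorm R d.+1)).
have -> : cone_over A = (@enorm R d.+1) @^-1` `]0, 1]%classic `&`
    (fun x : 'rV[R]_d.+1 => (enorm x)^-1 *: x) @^-1` A.
  by apply/seteqP; split => x; rewrite /cone_over /= in_itv.
apply: measurableI; last exact: measurable_preimageT mh mA.
exact: (measurable_preimageT (@measurable_enorm R d.+1) (measurable_itv _)).
Qed.

Lemma cone_over_le_eball (R : realType) d (A : set (borel_rV R d.+1)) :
  measurable A ->
  (lebesgueB R d.+1 (cone_over A) <= lebesgueB R d.+1 (eball 1))%E.
Proof.
move=> mA; apply: (@le_lebesgue_rV R d.+1 (cone_over A) (eball 1)).
- exact: measurable_cone_over.
- exact: measurable_eball.
- by move=> x [/andP[_ x1] _].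
Qed.

Lemma cone_over_fin_num (R : realType) d (A : set (borel_rV R d.+1)) :
  measurable A -> lebesgueB R d.+1 (cone_over A) \is a fin_num.
Proof.
move=> mA; rewrite ge0_fin_numE; last exact: measure_ge0.
apply: le_lt_trans (cone_over_le_eball mA) _.
by rewrite -ge0_fin_numE ?eball_fin_num//; exact: measure_ge0.
Qed.

Lemma closed_sphere (R : realType) d : closed (sphere d : set 'rV[R]_d.+1).
Proof.
apply: (@closed_comp _ _ (@enorm R d.+1) [set y | y = 1]) => [x _|].
  exact: continuous_enorm.
exact: closed_eq.
Qed.

Section sphere_measure_measure.
Context {R : realType} {d : nat}.
Local Notation mu := (@sphere_measure R d).

Let mu0 : mu set0 = 0%E.
Proof.
rewrite /sphere_measure (_ : cone_over set0 = set0); last first.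
  by apply/seteqP; split => // x [].
by rewrite [lebesgue_rV set0](measure0 (lebesgueB R d.+1)) mul0e.
Qed.

Let mu_ge0 A : (0 <= mu A)%E.
Proof.
rewrite /sphere_measure mule_ge0//; first exact: (measure_ge0 (lebesgueB R d.+1)).
by rewrite lee_fin invr_ge0 fine_ge0//; exact: (measure_ge0 (lebesgueB R d.+1)).
Qed.

Let mu_sigma_additive : semi_sigma_additive mu.
Proof.
move=> F mF tF mUF; rewrite /sphere_measure.
set c := (fine _)^-1%:E.
have -> : (fun n => \sum_(0 <= i < n) (lebesgue_rV (cone_over (F i)) * c))%E =
    (fun n => (\sum_(0 <= i < n) lebesgueB R d.+1 (cone_over (F i))) * c)%E.
  by apply/funext => n; rewrite ge0_sume_distrl// => i _; exact: measure_ge0.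
apply: cvgeZr => //.
have -> : cone_over (\bigcup_n F n) = \bigcup_n cone_over (F n).
  apply/seteqP; split => x; first by move=> [x1 [n _ Fx]]; exists n.
  by move=> [n _ [x1 Fx]]; split => //; exists n.
apply: (@measure_semi_sigma_additive _ _ _ (lebesgueB R d.+1)).
- by move=> i; exact: measurable_cone_over.
- apply/trivIsetP => i j _ _ ij; apply/seteqP; split => // x [[_ Fi] [_ Fj]].
  by move/trivIsetP : tF => /(_ i j I I ij) /seteqP[/(_ _ (conj Fi Fj))].
- apply: bigcupT_measurable => i; exact: measurable_cone_over.
Qed.

HB.instance Definition _ :=
  isMeasure.Build _ _ _ mu mu0 mu_ge0 mu_sigma_additive.

Lemma integral_sphere_indic (A : set (borel_rV R d.+1)) : measurable A ->
  (\int[mu]_(x in sphere d) (\1_A x)%:E)%E = mu (A `&` sphere d).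
Proof.
by move=> mA; rewrite integral_indic//; exact: measurable_rV_closed (@closed_sphere R d).
Qed.

End sphere_measure_measure.

(** * Normals of the hyperplanes that hit a body *)

Section hitting.
Context {R : realType} {d : nat}.
Implicit Types (K : set 'rV[R]_d.+1) (e : 'rV[R]_d.+1).

Definition hit K : set 'rV[R]_d.+1 := [set y | orthocomp y `&` K !=set0].

(** The complement is open by the tube lemma: <y, k> stays nonzero near each (y, k), uniformly over
    the compact [K]. This yields measurability. *)
Lemma closed_hit K : compact K -> closed (hit K).
Proof.
move=> cK; rewrite -[hit K]setCK; apply: open_closedC; rewrite openE => y yK.
have /= := (compact_near_coveringP K).1 cK 'rV[R]_d.+1 (nbhs y)
  (fun y' k => dotp y' k != 0) _ _.
have dK k : K k -> \forall k' \near k & y' \near y, dotp y' k' != 0.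
  move=> Kk.
  have yk : dotp y k != 0 by apply/eqP => yk; apply: yK; exists k.
  have c : continuous (fun z : 'rV[R]_d.+1 * 'rV[R]_d.+1 => dotp z.2 z.1).
    by apply: continuous_dotp => z; [exact: cvg_snd|exact: cvg_fst].
  have : \forall z \near (k, y), dotp z.2 z.1 != 0.
    have : nbhs (dotp y k) [set t : R | t != 0].
      by apply: open_nbhs_nbhs; split => //; exact: open_neq.
    exact: (c (k, y)).
  by [].
move=> /(_ _ dK) h; apply: filterS h => y' h [k [/eqP yk Kk]].
by have := h k Kk; rewrite yk.
Qed.

Lemma compact_sphere_closed K : closed K -> K `<=` sphere d -> compact K.
Proof.
move=> clK Ks; apply: bounded_closed_compact => //.
exists 1; split => // M M1 x /Ks x1.
rewrite /Num.norm /= mx_normrE; apply: bigmax_le; first by lra.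
by move=> [i j] _ /=; rewrite ord1 (le_trans (coord_enorm x j))// x1 ltW.
Qed.

Lemma measurable_hit K : closed K -> K `<=` sphere d ->
  measurable (hit K `&` sphere d : set (borel_rV R d.+1)).
Proof.
move=> clK Ks; apply: measurable_rV_closed; apply: closedI.
  by apply: closed_hit; exact: compact_sphere_closed.
exact: closed_sphere.
Qed.

Lemma U1E K : closed K -> K `<=` sphere d ->
  U1 K = 2^-1 * (fine (lebesgueB R d.+1 (cone_over (hit K `&` sphere d))) /
    fine (lebesgueB R d.+1 (cone_over (sphere d)))).
Proof.
move=> clK Ks; rewrite /U1 integral_sphere_indic; last first.
  by apply: measurable_rV_closed; apply: closed_hit; exact: compact_sphere_closed.
rewrite /sphere_measure -/(hit K); congr (_ * _); rewrite fineM //.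
exact: cone_over_fin_num (measurable_hit clK Ks).
Qed.

Lemma closed_sball e a : sphere d e -> 0 <= a <= pi -> closed (sball e a).
Proof.
move=> e1 api.
have -> : sball e a = sphere d `&` [set y | cos a <= dotp e y].
  apply/seteqP; split => y [y1 ya]; split => //=.
    by apply/(in_sball e1 y1 api); split.
  by have /(in_sball e1 y1 api)[] := ya.
apply: closedI; first exact: closed_sphere.
apply: (@closed_comp _ _ (dotp e) [set t | cos a <= t]) => [x _|].
  by apply: (@continuous_dotp _ _ _ (cst e) idfun) => z;
    [exact: cst_continuous|exact: cvg_id].
exact: closed_ge.
Qed.

(** The reflection exchanging the centres carries one hitting cone to the other. This allows the
    arbitrary centre of the theorem to be replaced by an incentre. *)
Lemma U1_sball e e' a : sphere d e -> sphere d e' -> 0 <= a <= pi ->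
  U1 (sball e a) = U1 (sball e' a).
Proof.
move=> e1 e1' api.
have [M [MM eM _]] := reflection_exists (sphere_dotp e1) (sphere_dotp e1').
have MT : M^T *m M = 1%:M by exact: mulmx1C.
have sub f : sball f a `<=` sphere d by move=> y [].
have enormM x : enorm (x *m M) = enorm x by rewrite /enorm dotp_mulmx.
rewrite !U1E //; [|exact: closed_sball..].
congr (_ * (fine _ / _)).
rewrite -[RHS](lebesgue_rV_isometry MM); last first.
  by apply: measurable_cone_over; apply: measurable_hit => //; exact: closed_sball.
congr (lebesgueB _ _ _); apply/seteqP; split => x; rewrite /cone_over /= enormM.
  move=> [xn [[k [xk [k1 ek]]] xs]]; split => //; split; last first.
    by rewrite /sphere /= scalemxAl enormM.
  exists (k *m M); split; last split.
  - by rewrite /orthocomp /= scalemxAl dotp_mulmx.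
  - by rewrite /sphere /= enormM.
  - by rewrite -eM dotp_mulmx.
move=> [xn [[k [xk [k1 ek]]] xs]]; split => //; split; last first.
  by rewrite /sphere /= -enormM -scalemxAl.
have kE : k = k *m M^T *m M by rewrite -mulmxA MT mulmx1.
exists (k *m M^T); split; last split.
- by rewrite /orthocomp /= -(dotp_mulmx _ _ MM) -kE -scalemxAl.
- by rewrite /sphere /= -enormM -kE.
- by rewrite -(dotp_mulmx _ _ MM) -kE eM.
Qed.

End hitting.

(** * Constants *)

Section constants.
Context {R : realType}.

(** From 3 <= pi <= 16/5: 3 / (16/5)^4 is just above 143/5000 = 0.0286, and 3 / 3^4 = 1/27. *)
Lemma pi4_bounds : (143 / 5000 : R) <= 3 * (pi : R) ^- 4 <= 1 / 27.
Proof.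
have p3 := @pi_ge3 R; have p4 := @pi_le_16_5 R.
have h1 : (3 : R) ^+ 4 <= pi ^+ 4 by rewrite ler_pXn2r ?nnegrE//; lra.
have h2 : pi ^+ 4 <= (16 / 5 : R) ^+ 4 by rewrite ler_pXn2r ?nnegrE//; lra.
have p0 : 0 < (pi : R) ^+ 4 by rewrite exprn_gt0// pi_gt0.
by rewrite ler_pdivlMr// ler_pdivrMr//; apply/andP; split; lra.
Qed.

(** As 143/5000 is 1.43 times 0.02, the claim reduces to 0.04 * 8 (n+2) <= 1.43^(n+1), which
    Bernoulli's inequality gives. *)
Lemma constant_ge n :
  2 * (2 / 100) ^+ n.+2 <= (8 * n.+2%:R)^-1 * (3 * pi ^- 4) ^+ n.+1 :> R.
Proof.
have /andP[] := pi4_bounds; move: (3 * pi ^- 4) => k k1 _.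
have bern (j : nat) : 1 + 43 / 100 * j%:R <= (143 / 100) ^+ j :> R.
  elim: j => [|j IH]; first by rewrite expr0; lra.
  rewrite exprS -natr1; have j0 : 0 <= j%:R :> R by [].
  have : 143 / 100 * (1 + 43 / 100 * j%:R) <= 143 / 100 * (143 / 100) ^+ j :> R.
    by rewrite ler_pM2l//; lra.
  lra.
have h1 : (143 / 5000) ^+ n.+1 <= k ^+ n.+1 by apply: lerXn2r => //; rewrite nnegrE; lra.
have n0 : 0 < 8 * n.+2%:R :> R by rewrite mulr_gt0.
rewrite [leRHS]mulrC ler_pdivlMr//; apply: le_trans h1.
have -> : (143 / 5000 : R) = (143 / 100) * (2 / 100) by field.
rewrite (exprMn _ (143 / 100)).
rewrite [X in X * _ <= _](_ : _ = (2 / 100) ^+ n.+1 * (4 / 100)); last first.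
  by rewrite exprSr; field.
rewrite -mulrA mulrC ler_pM2r ?exprn_gt0//.
apply: le_trans (bern _).
have -> : n.+2%:R = n%:R + 2 :> R by rewrite -addn2 natrD.
have -> : n.+1%:R = n%:R + 1 :> R by rewrite -addn1 natrD.
by have : 0 <= n%:R :> R by []; lra.
Qed.

(** One factor is compared per dimension: k a s <= w for each of the n powers, and the rest
    numerically. Here s and w stand for the square roots of r and of 2/100. *)
Let constant_le_aux n (k a s w N : R) : 0 < k -> k <= 1 / 27 -> 0 < a -> a <= 8 / 5 ->
  0 < s -> s <= 253 / 200 -> 14 / 100 <= w -> 0 < N -> N^-1 <= 2^-1 ->
  N^-1 * (k * s / 2) * (k * a * s) ^+ n <= 47 / 50 * (49 / 400) * w * w ^+ n.
Proof.
move=> k0 k1 a0 a1 s0 s1 w1 N0 n2.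
have ka0 : 0 <= k * a by rewrite mulr_ge0 ?ltW.
have kas0 : 0 <= k * a * s by apply: mulr_ge0 => //; exact: ltW.
have ks0 : 0 <= k * s / 2 by apply: divr_ge0 => //; apply: mulr_ge0; exact: ltW.
have N1 : 0 <= N^-1 by rewrite invr_ge0 ltW.
have kas : k * a * s <= w.
  have h1 : k * a <= 1 / 27 * (8 / 5) by apply: ler_pM => //; exact: ltW.
  have h2 : k * a * s <= 1 / 27 * (8 / 5) * (253 / 200).
    by apply: ler_pM => //; exact: ltW.
  by clear -h2 w1; lra.
have ks : k * s <= 1 / 27 * (253 / 200) by apply: ler_pM => //; exact: ltW.
have w0 : 0 <= w by clear -w1; lra.
apply: ler_pM => //.
- exact: mulr_ge0.
- exact: exprn_ge0.
- apply: (@le_trans _ _ (2^-1 * (1 / 27 * (253 / 200) / 2))).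
    by apply: ler_pM => //; clear -ks; lra.
  by clear -w1; lra.
- exact: lerXn2r.
Qed.

(** The right side is the volume of the box divided by that of the unit (d-1)-ball, for d = n+2; the
    4 on the left is the ratio allowed between the (d+1)-ball and the (d-1)-ball. Both sides contain
    eps times the power n+1 of the square root of eps r. The numerical bounds come from 0.14^2 <
    0.02 and from r <= 8/5 < 1.265^2. *)
Lemma constant_le n (a r eps : R) : 0 < a -> 0 < r -> a + r = pi / 2 -> 0 < eps ->
  4 * ((8 * n.+2%:R)^-1 * (3 * pi ^- 4) ^+ n.+1 * a ^+ n * r ^+ n.+1
       * eps `^ ((n.+2%:R + 1) / 2)) <=
  (97 / 100 - 1 / 2) * (2 * (49 / 400 * eps)) *
    Num.sqrt (2 / 100 * (eps * r)) ^+ n.+1.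
Proof.
move=> a0 r0 ar ep0; have p4 := @pi_le_16_5 R.
have /andP[k0 k1] := pi4_bounds; move: (3 * pi ^- 4) k0 k1 => k k0 k1.
have epE : eps `^ ((n.+2%:R + 1) / 2) = eps * Num.sqrt eps ^+ n.+1.
  have -> : (n.+2%:R + 1) / 2 = 1 + 2^-1 * n.+1%:R :> R.
    by rewrite -(addn2 n) -(addn1 n) !natrD; field.
  rewrite powRD ?(gt_eqF ep0) ?implybT// powRr1 ?ltW// powRrM.
  by rewrite powR_mulrn ?powR_ge0// powR12_sqrt ?ltW.
set s := Num.sqrt r; have s0 : 0 < s by rewrite sqrtr_gt0.
have rE : r = s ^+ 2 by rewrite sqr_sqrtr ?ltW.
set t := Num.sqrt eps; have t0 : 0 < t by rewrite sqrtr_gt0.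
have zE : Num.sqrt (2 / 100 * (eps * r)) = Num.sqrt (2 / 100) * (t * s).
  by rewrite !sqrtrM// ?ltW//; lra.
rewrite epE zE -/t {epE zE}.
set w := Num.sqrt (2 / 100).
have w1 : 14 / 100 <= w.
  have w0 : 0 <= w by exact: sqrtr_ge0.
  have w2 : w ^+ 2 = 2 / 100 by rewrite sqr_sqrtr//; lra.
  rewrite leNgt; apply/negP => h.
  have : 0 < (14 / 100 - w) * (14 / 100 + w) by apply: mulr_gt0; lra.
  lra.
have s1 : s <= 253 / 200.
  rewrite leNgt; apply/negP => h.
  have : 0 < (s - 253 / 200) * (s + 253 / 200) by apply: mulr_gt0; lra.
  lra.
have n2 : n.+2%:R^-1 <= 2^-1 :> R by rewrite lef_pV2 ?posrE// ler_nat.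
have n0 : 0 < n.+2%:R :> R by [].
move: n.+2%:R n0 n2 => N N0 n2.
have -> : 4 * ((8 * N)^-1 * k ^+ n.+1 * a ^+ n * r ^+ n.+1 * (eps * t ^+ n.+1)) =
  (N^-1 * (k * s / 2) * (k * a * s) ^+ n) * (eps * (t * s) ^+ n.+1).
  by rewrite rE !exprMn !exprS; field; rewrite gt_eqF.
have -> : (97 / 100 - 1 / 2) * (2 * (49 / 400 * eps)) * (w * (t * s)) ^+ n.+1 =
  (47 / 50 * (49 / 400) * w * w ^+ n) * (eps * (t * s) ^+ n.+1).
  by rewrite !exprMn !exprS; field.
rewrite ler_pM2r; last by rewrite mulr_gt0// exprn_gt0// mulr_gt0.
apply: constant_le_aux => //; clear -ar p4 r0 a0 k0; lra.
Qed.

End constants.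

Lemma U1_gap (R : realType) (n : nat) (a eps c : R) (K : set 'rV[R]_n.+3) :
  sconvex_body K -> 0 < a -> 0 < eps <= 1 -> a <= inradius K -> eps <= vartheta_r K ->
  c = (8 * n.+2%:R)^-1 * (3 * pi ^- 4) ^+ n.+1 * a ^+ n * (pi / 2 - a) ^+ n.+1 ->
  forall e : 'rV[R]_n.+3, sphere n.+2 e ->
    (1 + c * eps `^ ((n.+2%:R + 1) / 2)) * U1 (sball e a) <= U1 K.
Proof.
move=> [C [clC coneC nlin ->{K}]] a0 epi aK epK cE e e1.
have /andP[ep0 ep1] := epi.
have [api epr [e0 [y [[e01 Ce0] ballK [y1 Cy] ya]]]] :=
  inradius_far_point clC coneC nlin a0 aK ep0 epK.
have pi0 := @pi_gt0 R.
have a_pi : 0 <= a <= pi by apply/andP; split; lra.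
have a_itv : 0 < a < pi / 2 by rewrite a0.
have r0 : 0 < pi / 2 - a by lra.
set K := sphere n.+2 `&` C in ballK *.
have [p [q [p1 q1 pq boxP]]] := frame_box_cap e01 y1 a_itv epi epr ya.
set X := frame_box p q _ _ _ _ in boxP.
have Z0 := cap_radius_gt0 a_itv epi.
have clB := closed_sball e01 a_pi.
have Bs : sball e0 a `<=` sphere n.+2 by move=> z [].
have clK : closed K by apply: closedI => //; exact: closed_sphere.
have Ks : K `<=` sphere n.+2 by move=> z [].
have mB := measurable_hit clB Bs; have mK := measurable_hit clK Ks.
have mX : measurable X by exact: measurable_frame_box.
rewrite (U1_sball e1 e01 a_pi) !U1E //.
set HB := cone_over (hit (sball e0 a) `&` _).
set HK := cone_over (hit K `&` _).
have mHB : measurable (HB : set (borel_rV R n.+3)) by exact: measurable_cone_over.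
have mHK : measurable (HK : set (borel_rV R n.+3)) by exact: measurable_cone_over.
(* On the box, <x, k> < 0 for every k in the ball, so no such hyperplane meets the ball. *)
have BX0 : HB `&` X = set0.
  apply/seteqP; split => // x [[/andP[x0 _] [[k [xk [k1 ek]]] _]] Xx].
  have [_ xe sxe _] := boxP x Xx.
  have : dotp x k < 0.
    apply: (dotp_lt0_sball a_itv e01 k1 _ xe sxe).
    exact: (in_sball e01 k1 a_pi).1 (conj k1 ek).
  move: xk; rewrite /orthocomp /= dotpZl => /eqP.
  by rewrite mulf_eq0 invr_eq0 gt_eqF//= => /eqP ->; rewrite ltxx.
have BXK : HB `|` X `<=` HK.
  move=> x [[xn [[k [xk Bk]] xs]]|Xx].
    by do 2!split => //; exists k; split => //; exact: ballK.
  have [xn xe _ xy] := boxP x Xx.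
  have [x0 _] := andP xn.
  have ey : -1 < dotp e0 y.
    have /andP[b1 _] := dotp_unit_bound e01 y1; move: ya => /andP[_ ya].
    rewrite lt_neqAle b1 andbT; apply/eqP => yN.
    by move: ya; rewrite -yN acosN1; lra.
  have [k [xk Kk]] := cone_orthogonal coneC Ce0 Cy e01 y1 ey xe xy.
  split => //; split; last by apply: normalize_sphere; rewrite -enorm_gt0.
  by exists k; split => //; rewrite /orthocomp /= dotpZl xk mulr0.
have mS : measurable (sphere n.+2 : set (borel_rV R n.+3)).
  exact: measurable_rV_closed (@closed_sphere R n.+2).
set lam := lebesgueB R n.+3.
have HB_fin : lam HB \is a fin_num by exact: cone_over_fin_num mB.
have HK_fin : lam HK \is a fin_num by exact: cone_over_fin_num mK.
have S_fin : lam (cone_over (sphere n.+2)) \is a fin_num by exact: cone_over_fin_num mS.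
have lamX : lam X = (((97 / 100 - 1 / 2) * (2 * (49 / 400 * eps)) *
    cap_radius a eps ^+ n.+1)%:E * lebesgueB R n.+1 (eball 1))%E.
  by apply: (lebesgue_frame_box p1 q1 pq _ _ Z0); clear -ep0; lra.
move: lamX; move vE : (_ * cap_radius a eps ^+ n.+1) => v lamX.
have v0 : 0 < v.
  by rewrite -vE; apply: mulr_gt0; [clear -ep0; lra|exact: exprn_gt0].
have b_fin := eball_fin_num n.+1 (1 : R).
have b_gt0 := eball1_gt0 R n.+1.
have XK : (lam HB + lam X <= lam HK)%E.
  rewrite /lam -(measureU (lebesgueB R n.+3) mHB mX BX0).
  exact: (le_lebesgue_rV (measurableU _ _ mHB mX) mHK BXK).
(* From dimension d+1 down to d-1, with a factor 2 at each step. *)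
have S4 : (lam (cone_over (sphere n.+2)) <=
    2%:E * (2%:E * lebesgueB R n.+1 (eball 1)))%E.
  apply: (le_trans (cone_over_le_eball mS)).
  apply: (le_trans (eball1_le R n.+2)).
  by apply: lee_wpmul2l (eball1_le R n.+1).
have mCS := measurable_cone_over mS.
have BS : (lam HB <= lam (cone_over (sphere n.+2)))%E.
  by apply: (le_lebesgue_rV mHB mCS) => x [xn [_ xs]].
have XS : (lam X <= lam (cone_over (sphere n.+2)))%E.
  apply: (le_lebesgue_rV mX mCS) => x Xx.
  by have /BXK [xn [_ xs]] : (HB `|` X) x by right.
have HB0 : (0 <= lam HB)%E by exact: measure_ge0.
have cle := @constant_le R n a (pi / 2 - a) eps a0 r0 _ ep0.
rewrite -cE -/(cap_radius a eps) vE in cle.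
have {cE}ce0 : 0 <= c * eps `^ ((n.+2%:R + 1) / 2).
  apply: mulr_ge0; last exact: powR_ge0.
  have /andP[k0 _] := @pi4_bounds R.
  rewrite cE; do 3?[apply: mulr_ge0];
    rewrite ?invr_ge0 ?exprn_ge0 ?mulr_ge0 ?(ltW a0) ?(ltW r0)//.
  by clear -k0; lra.
have {}cle : 4 * (c * eps `^ ((n.+2%:R + 1) / 2)) <= v by apply: cle; ring.
move: (c * _) ce0 cle => t t0 tv.
rewrite lamX in XK XS.
clear -HB_fin HK_fin S_fin b_fin b_gt0 XK XS S4 BS HB0 t0 tv v0.
move: (lam HB) (lam HK) (lam (cone_over _)) (lebesgueB _ _ _)
  HB_fin HK_fin S_fin b_fin b_gt0 XK XS S4 BS HB0.
move=> [hb| |] // [hk| |] // [s| |] // [b| |] // _ _ _ _.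
rewrite -!EFinM -EFinD !lee_fin lte_fin /= => b0 XK XS S4 BS HB0.
have s0 : 0 < s by apply: lt_le_trans XS; exact: mulr_gt0.
(* The factor 1/2 and the normalisation [s] cancel. What remains is (1 + t) hb <= hk, from hb + v b
   <= hk and t hb <= 4 t b <= v b. *)
rewrite mulrCA ler_pM2l ?invr_gt0// mulrA ler_pM2r ?invr_gt0//.
apply: le_trans XK; rewrite mulrDl mul1r lerD2l.
have h1 : t * hb <= t * (2 * (2 * b)) by apply: ler_wpM2l => //; exact: le_trans S4.
apply: (le_trans h1); have h2 : 4 * t * b <= v * b by apply: ler_wpM2r => //; exact: ltW.
by clear -h2; lra.
Qed.

Unset Implicit Arguments.
Set Strict Implicit.
Set Printing Implicit Defensive.

Theorem theorem4p8 (R : realType) (d : nat) (a : R)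
    (hd : (2 <= d)%N) (ha : 0 < a) :
  exists c : R,
    [/\ (8 * d%:R)^-1 * (3 * pi ^- 4) ^+ (d - 1) * a ^+ (d - 2)
          * (pi / 2 - a) ^+ (d - 1) <= c,
        a <= pi / 2 ->
          2 * (2 / 100) ^+ d * a ^+ (d - 2) * (pi / 2 - a) ^+ (d - 1)
          <= (8 * d%:R)^-1 * (3 * pi ^- 4) ^+ (d - 1) * a ^+ (d - 2)
             * (pi / 2 - a) ^+ (d - 1)
      & forall (K : set 'rV[R]_d.+1) (eps : R),
          sconvex_body K -> 0 < eps <= 1 ->
          a <= inradius K -> eps <= vartheta_r K ->
          forall e : 'rV[R]_d.+1, sphere d e ->
            (1 + c * eps `^ ((d%:R + 1) / 2)) * U1 (sball e a) <= U1 K].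
Proof.
case: d hd => [|[|n]] // _.
have -> : (n.+2 - 1 = n.+1)%N by rewrite subn1.
have -> : (n.+2 - 2 = n)%N by rewrite subn2.
(* The constant is the required lower bound itself. *)
eexists; split; first exact: lexx.
  move=> api; rewrite ler_wpM2r ?exprn_ge0 ?subr_ge0//.
  by rewrite ler_wpM2r ?exprn_ge0 ?(ltW ha)//; exact: constant_ge.
by move=> K eps Kconv epi aK epK; exact: U1_gap Kconv ha epi aK epK erefl.
Qed.
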